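(* Consider the following promise problem. Input: a string $x$, the number $k=K(x)$, and an integer $\alpha\in[\varepsilon,k-\varepsilon]$, where $\varepsilon=|x|/(10\log|x|)$. Output: $1$ if $\lambda_x(\alpha-\varepsilon)<k+6\log k$; $0$ if $\lambda_x(\alpha+\varepsilon)>k+3\varepsilon$; if neither case occurs, any output (or none) is allowed. There is no algorithm $A$ that solves this promise problem for all $x$ (i.e., halts with the required output on every input falling into one of the two cases).
   Context: $K$ is prefix Kolmogorov complexity w.r.t. a fixed reference universal prefix machine. For a finite set $S$, $K(S)$ is the length of a shortest program listing $S$, $\Lambda(S)=K(S)+\log|S|$ (log base 2), and $\lambda_x(\alpha)=\min\{\Lambda(S): S\text{ finite},x\in S,K(S)\le\alpha\}$. *)

(* Defs.v *)
From mathcomp Require Import all_boot all_order all_algebra.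
From mathcomp Require Import finmap.
From mathcomp Require Import all_classical all_reals all_analysis.

Set Implicit Arguments.
Unset Strict Implicit.
Unset Printing Implicit Defensive.

Import Order.TTheory GRing.Theory Num.Theory.

Local Open Scope ring_scope.

(* Kleene's partial recursive functions. Terms are not indexed by arity: a term
   denotes a partial function of a list of arguments, in which missing
   arguments count as 0 and superfluous ones are ignored. *)
Inductive recfun : Type :=
  | Zero
  | Succ
  | Proj of nat
  | Comp of recfun & seq recfun
  | Prec of recfun & recfun
  | Mu of recfun.

(* [rec_eval e xs y]: the function denoted by e is defined at xs, with value y.
   - h = Prec f g satisfies h(0, xs) = f(xs) and
     h(n + 1, xs) = g(n, h(n, xs), xs);
   - Mu f maps xs to the least n with f(n, xs) = 0, provided that f(m, xs) is
     defined for all m < n. *)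
Fixpoint rec_eval (e : recfun) (xs : seq nat) (y : nat) {struct e} : Prop :=
  match e with
  | Zero => y = 0%N
  | Succ => y = (nth 0%N xs 0).+1
  | Proj i => y = nth 0%N xs i
  | Comp f gs =>
      exists2 ys : seq nat,
        (fix rec_evals (gs : seq recfun) (ys : seq nat) {struct gs} : Prop :=
           match gs, ys with
           | [::], [::] => True
           | g :: gs', y' :: ys' => rec_eval g xs y' /\ rec_evals gs' ys'
           | _, _ => False
           end) gs ys
        & rec_eval f ys y
  | Prec f g =>
      (fix loop (n : nat) (z : nat) {struct n} : Prop :=
         match n with
         | 0%N => rec_eval f (behead xs) z
         | m.+1 => exists2 z' : nat,
             loop m z' & rec_eval g [:: m, z' & behead xs] z
         end) (head 0%N xs) y
  | Mu f =>
      rec_eval f (y :: xs) 0%N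
      /\ forall m, (m < y)%N -> exists z, rec_eval f (m :: xs) z.+1
  end.

Notation bitstring := (seq bool).

(* Bijective base-2 numeration, least significant digit first: the digits 1 and
   2 stand for the bits 0 and 1. *)
Definition string_code (s : bitstring) : nat :=
  foldr (fun (b : bool) (n : nat) => (n.*2 + b.+1)%N) 0%N s.

Lemma string_code_bij : bijective string_code.
Proof.
pose fix dec (fuel n : nat) {struct fuel} : bitstring :=
  match fuel, n with
  | f.+1, m.+1 => odd m :: dec f m./2
  | _, _ => [::]
  end.
have decK f n : (n <= f)%N -> string_code (dec f n) = n.
  elim: f n => [|f IH] [|m] //= le_mf.
  rewrite -/(string_code _) IH; last by rewrite -divn2 (leq_trans (leq_div m 2)).
  by rewrite addnS addnC odd_double_half.
have code_inj : injective string_code.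
  elim=> [|b s IH] [|c t] //=; rewrite -?/(string_code _) ?addnS // => -[].
  rewrite ![(_.*2 + _)%N]addnC => eq_bc.
  have := congr1 odd eq_bc; rewrite !oddD !odd_double !addbF !oddb => eqb.
  by have := congr1 half eq_bc; rewrite !half_bit_double eqb => /IH ->.
exists (fun n => dec n n) => [s|n]; last exact: decK.
by apply: code_inj; rewrite decK.
Qed.

(* [runs e p y]: the machine e halts on program p with output y. *)
Definition runs (e : recfun) (p y : bitstring) : Prop :=
  rec_eval e [:: string_code p] (string_code y).

Definition prefix_machine (e : recfun) : Prop :=
  forall p q y z, runs e p y -> runs e q z -> prefix p q -> p = q.

Definition universal_prefix_machine (u : recfun) : Prop :=
  prefix_machine u /\
  forall e, prefix_machine e ->
    exists s : bitstring, forall p y, runs u (s ++ p) y <-> runs e p y.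

(* The minimal length of an element of P; it is the junk value 0 when P is
   empty, which does not happen below when the machine is universal, see
   universal_outputs. *)
Definition min_size (P : set bitstring) : nat :=
  xget 0%N [set k : nat | (exists2 p, P p & size p = k)
                          /\ forall p, P p -> (k <= size p)%N].

Definition K (u : recfun) (x : bitstring) : nat :=
  min_size [set p | runs u p x].

(* The self-delimiting code 1^|x| 0 x of x. *)
Definition selfdelim (x : bitstring) : bitstring :=
  nseq (size x) true ++ false :: x.

Definition listing (l : seq bitstring) : bitstring := flatten (map selfdelim l).

(* The elements of S may be listed in any order, without repetition. *)
Definition Kset (u : recfun) (S : {fset bitstring}) : nat :=
  min_size [set p | exists2 l : seq bitstring,
                      perm_eq l (enum_fset S) & runs u p (listing l)].

Definition log2 (R : realType) (r : R) : R := ln r / ln 2.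

Definition Lambda (R : realType) (u : recfun) (S : {fset bitstring}) : R :=
  (Kset u S)%:R + log2 #|` S|%:R.

(* As only finitely many S satisfy K(S) <= a, the infimum is a minimum, or +oo
   if there is no admissible S. *)
Definition lambda (R : realType) (u : recfun) (x : bitstring) (a : R) : \bar R :=
  ereal_inf [set (Lambda R u S)%:E | S in
    [set S : {fset bitstring} | x \in S /\ (Kset u S)%:R <= a]].

Definition epsilon (R : realType) (x : bitstring) : R :=
  (size x)%:R / (10 * log2 (size x)%:R).

Lemma universal_outputs (u : recfun) (y : bitstring) :
  universal_prefix_machine u -> exists p, runs u p y.
Proof.
move=> [_ univ].
pose e := iter (string_code y) (fun f => Comp Succ [:: f]) (Mu (Proj 1)).
have evalE c n z :
    rec_eval (iter c (fun f => Comp Succ [:: f]) (Mu (Proj 1))) [:: n] z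
    <-> n = 0%N /\ z = c.
  elim: c n z => [|c IH] n z.
    split=> /= [[<- Hm]|[-> ->]]; last by [].
    by split=> //; case: z Hm => // z /(_ 0%N isT) [].
  split=> /= [[[|y' [|y'' ys]] // + ->]|[-> ->]].
  - by move=> [/IH [-> ->]].
  - by move=> [].
  by exists [:: c] => //; split=> //; apply/IH.
have code0 p : string_code p = 0%N -> p = [::].
  by case: p => //= b p; rewrite addnS.
have pe : prefix_machine e.
  by move=> p q a b /evalE [/code0 -> _] /evalE [/code0 -> _].
have [s us] := univ e pe.
by exists (s ++ [::]); apply/us/evalE.
Qed.

Lemma min_sizeP (P : set bitstring) : (exists p, P p) ->
  (exists2 p, P p & size p = min_size P)
  /\ forall p, P p -> (min_size P <= size p)%N.
Proof.
move=> [p0 Pp0]; rewrite /min_size; case: xgetP => [k _ //|noP].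
pose Q n := `[< exists2 p, P p & size p = n >].
have exQ : exists n, Q n by exists (size p0); apply/asboolP; exists p0.
case: (ex_minnP exQ) => n /asboolP Qn minn.
case: (noP n); split=> // p Pp.
by apply: minn; apply/asboolP; exists p.
Qed.

(* Main.v *)
Require Import Defs.
From mathcomp Require Import all_boot all_order all_algebra.
From mathcomp Require Import finmap.
From mathcomp Require Import all_classical all_reals all_analysis.
From mathcomp Require Import zify lra.

Set Implicit Arguments.
Unset Strict Implicit.
Unset Printing Implicit Defensive.

Import Order.TTheory GRing.Theory Num.Theory.

Local Open Scope nat_scope.

(* Suppose that A solves the promise problem. For n = 2^(2^i), a process
   enumerates distinct strings x_0, x_1, ... of length n, at most 2^m of them,
   where m = n/4. Cut the indices into aligned blocks of 2^(m-(d+1)a) indices,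
   for each level d < l, where the gap a exceeds 2 epsilon. Before the process
   leaves a block of level d, it waits until every x in it is settled, i.e.
   - a program for x of length < m - 1 has shown up, or
   - a program of length at most about d a has shown up that lists a set
     containing x and having at most 2^M elements, where M > m + 3 epsilon, or
   - for some k in the window m - 1, ..., m + w, the answers of A on (x, k)
     at the thresholds alpha = theta_0, theta_1, ... of all levels jump from
     0 to 1 right after theta_d.
   Each new x_u lies in none of the small sets listed so far. So each listing
   program settles strings of a single block per level, and counting shows that
   the first two cases account for less than 2^m strings. If the process were
   to finish, A would thus commit some x to all l levels; but each k in the
   window accounts for one level at most, and l > w + 2. So the process gets
   stuck at some x in a block S of level d. As x is not settled, K(x) >= m - 1
   and no small set of complexity about d a contains x. On the other hand S is
   listed by a program that consists of (d+1)a bits locating S and of w bits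
   for i, d and the machine, so that K(x) <= m + w. With k = K(x) the promise
   therefore forces A to answer 0 up to theta_d and 1 from there on, and x is
   settled after all. It is essential that w = O(i) = O(log log n), whereas
   there is room for about log n levels. *)

Lemma recfun_nested_ind (P : recfun -> Prop) :
  P Zero -> P Succ -> (forall i, P (Proj i)) ->
  (forall f gs, P f -> (forall g, List.In g gs -> P g) -> P (Comp f gs)) ->
  (forall f g, P f -> P g -> P (Prec f g)) ->
  (forall f, P f -> P (Mu f)) -> forall e, P e.
Proof.
move=> P0 PS Pp Pc Pr Pm; fix IH 1 => -[||i|f gs|f g|f].
- exact: P0.
- exact: PS.
- exact: Pp.
- apply: Pc; first exact: IH.
  move: gs; fix IHs 1 => -[|g gs] h; first by case.
  by case=> [<-|]; [exact: IH | exact: IHs].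
- by apply: Pr; exact: IH.
- by apply: Pm; exact: IH.
Qed.

Definition rec_evals (xs : seq nat) :=
  fix rec_evals (gs : seq recfun) (ys : seq nat) {struct gs} : Prop :=
    match gs, ys with
    | [::], [::] => True
    | g :: gs', y' :: ys' => rec_eval g xs y' /\ rec_evals gs' ys'
    | _, _ => False
    end.

Lemma rec_eval_Comp f gs xs y :
  rec_eval (Comp f gs) xs y <->
  exists2 ys, rec_evals xs gs ys & rec_eval f ys y.
Proof. by []. Qed.

(** * Total recursive functions *)

(* A function of N arguments is given as a function of an environment, i.e.
   of the map sending i to the i-th argument. *)
Definition tot (N : nat) (F : (nat -> nat) -> nat) : Prop :=
  exists e, forall xs, size xs = N ->
    forall y, rec_eval e xs y <-> y = F (nth 0 xs).

Lemma tot_ext N F G :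
  (forall r, F r = G r) -> tot N F -> tot N G.
Proof. by move=> /funext ->. Qed.

Lemma tot_var N i : tot N (fun r => r i).
Proof. by exists (Proj i). Qed.

Lemma tot_zero N : tot N (fun=> 0).
Proof. by exists Zero. Qed.

Lemma rec_evals_tot N (Gs : seq ((nat -> nat) -> nat)) :
  (forall i, i < size Gs -> tot N (nth (fun=> 0) Gs i)) ->
  exists gs, forall xs, size xs = N ->
    forall ys, rec_evals xs gs ys <-> ys = [seq G (nth 0 xs) | G <- Gs].
Proof.
elim: Gs => [|G Gs IH] h; first by exists [::] => xs _ [].
have [g hg] := h 0 isT; have [gs hgs] := IH (fun i => h i.+1).
exists (g :: gs) => xs sxs [|y ys]; first by split.
by split=> [/= [/(hg _ sxs) -> /(hgs _ sxs) ->]|[-> ->]] //=; split;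
  [apply/(hg _ sxs) | apply/(hgs _ sxs)].
Qed.

Lemma tot_comp N F (Gs : seq ((nat -> nat) -> nat)) :
  tot (size Gs) F ->
  (forall i, i < size Gs -> tot N (nth (fun=> 0) Gs i)) ->
  tot N (fun r => F (nth 0 [seq G r | G <- Gs])).
Proof.
move=> [f hf] /rec_evals_tot [gs hgs]; exists (Comp f gs) => xs sxs y.
have sG : size [seq G (nth 0 xs) | G <- Gs] = size Gs by rewrite size_map.
rewrite rec_eval_Comp; split=> [[ys /(hgs _ sxs) -> /(hf _ sG)] //|->].
by eexists; [apply/(hgs _ sxs) | apply/(hf _ sG)].
Qed.

Lemma tot_app1 N f a : tot 1 (fun r => f (r 0)) -> tot N a ->
  tot N (fun r => f (a r)).
Proof. by move=> hf ha; apply: (@tot_comp N _ [:: a]) hf _ => -[]. Qed.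

Lemma tot_app2 N f a b : tot 2 (fun r => f (r 0) (r 1)) ->
  tot N a -> tot N b -> tot N (fun r => f (a r) (b r)).
Proof. by move=> hf ha hb; apply: (@tot_comp N _ [:: a; b]) hf _ => -[|[]]. Qed.

Lemma tot_app3 N f a b c : tot 3 (fun r => f (r 0) (r 1) (r 2)) ->
  tot N a -> tot N b -> tot N c -> tot N (fun r => f (a r) (b r) (c r)).
Proof.
by move=> hf ha hb hc; apply: (@tot_comp N _ [:: a; b; c]) hf _ => -[|[|[]]].
Qed.

Lemma tot_app4 N f a b c d : tot 4 (fun r => f (r 0) (r 1) (r 2) (r 3)) ->
  tot N a -> tot N b -> tot N c -> tot N d ->
  tot N (fun r => f (a r) (b r) (c r) (d r)).
Proof.
move=> hf ha hb hc hd.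
by apply: (@tot_comp N _ [:: a; b; c; d]) hf _ => -[|[|[|[]]]].
Qed.

Lemma tot_reindex m N F (G : nat -> (nat -> nat) -> nat) :
  tot m F -> (forall i, i < m -> tot N (G i)) ->
  tot N (fun r => F (fun i => if i < m then G i r else 0)).
Proof.
move=> hF hG; have := @tot_comp N F (mkseq G m); rewrite size_mkseq.
move=> /(_ hF) H; apply: tot_ext (H _) => [r|i im]; last first.
  by rewrite nth_mkseq //; exact: hG.
congr F; apply/funext => i; case: ifPn => im.
  by rewrite (nth_map (fun=> 0)) ?size_mkseq // nth_mkseq.
by rewrite nth_default // size_map size_mkseq leqNgt.
Qed.

Lemma tot_succ N a : tot N a -> tot N (fun r => (a r).+1).
Proof. by apply: tot_app1; exists Succ. Qed.

Lemma tot_const N c : tot N (fun=> c).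
Proof. by elim: c => [|c IH]; [exact: tot_zero | exact: tot_succ]. Qed.

Lemma tot_iteri N b f (g : nat -> nat -> (nat -> nat) -> nat) :
  tot N b -> tot N f ->
  tot N.+2 (fun r => g (r 0) (r 1) (fun i => r i.+2)) ->
  tot N (fun r => iteri (b r) (fun m z => g m z r) (f r)).
Proof.
move=> hb [ef hf] [eg hg].
have hfg : tot N.+1 (fun r => iteri (r 0)
    (fun m z => g m z (fun i => r i.+1)) (f (fun i => r i.+1))).
  exists (Prec ef eg) => -[//|n xs] [sxs] y /=.
  elim: n y => [|n IH] y /=; first exact: hf.
  have E z y' : rec_eval eg [:: n, z & xs] y' <-> y' = g n z (nth 0 xs).
    by apply: hg => /=; rewrite sxs.
  by split=> [[z /IH -> /E ->]|->] //; eexists; [apply/IH | apply/E].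
have hs : forall i, i < N.+1 ->
    tot N (if i is j.+1 then fun r => r j else b).
  by case=> [|j] _; [|exact: tot_var].
have [p hp] := tot_reindex hfg hs; exists p => xs sxs y; rewrite (hp _ sxs) /=.
suff -> : (fun i => if i < N then nth 0 xs i else 0) = nth 0 xs by [].
apply/funext => i; case: ifPn => //.
by rewrite -leqNgt -sxs => /(nth_default _).
Qed.

Notation totb N P := (tot N (fun r => nat_of_bool (P r))) (only parsing).

Lemma tot_pred N a : tot N a -> tot N (fun r => (a r).-1).
Proof.
apply: tot_app1; apply: (@tot_ext _ (fun r => iteri (r 0) (fun m _ => m) 0)).
  by move=> r; case: (r 0).
apply: (tot_iteri (g := fun m _ _ => m)); first exact: tot_var.
  exact: tot_zero.
exact: tot_var.
Qed.

Lemma tot_add N a b : tot N a -> tot N b -> tot N (fun r => a r + b r).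
Proof.
apply: tot_app2.
apply: (@tot_ext _ (fun r => iteri (r 1) (fun _ z => z.+1) (r 0))) => [r|].
  by elim: (r 1) => [|m /= ->]; rewrite ?addn0 ?addnS.
apply: (tot_iteri (g := fun _ z _ => z.+1)); try exact: tot_var.
by apply: tot_succ; exact: tot_var.
Qed.

Lemma tot_sub N a b : tot N a -> tot N b -> tot N (fun r => a r - b r).
Proof.
apply: tot_app2.
apply: (@tot_ext _ (fun r => iteri (r 1) (fun _ z => z.-1) (r 0))) => [r|].
  by elim: (r 1) => [|m /= ->]; rewrite ?subn0 ?subnS.
apply: (tot_iteri (g := fun _ z _ => z.-1)); try exact: tot_var.
by apply: tot_pred; exact: tot_var.
Qed.

Lemma tot_mul N a b : tot N a -> tot N b -> tot N (fun r => a r * b r).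
Proof.
apply: tot_app2.
apply: (@tot_ext _ (fun r => iteri (r 1) (fun _ z => r 0 + z) 0)) => [r|].
  by elim: (r 1) => [|m /= ->]; rewrite ?muln0 ?mulnS.
apply: (tot_iteri (g := fun _ z r => r 0 + z)); try exact: tot_var.
  exact: tot_zero.
by apply: tot_add; exact: tot_var.
Qed.

Lemma tot_exp N a b : tot N a -> tot N b -> tot N (fun r => a r ^ b r).
Proof.
apply: tot_app2.
apply: (@tot_ext _ (fun r => iteri (r 1) (fun _ z => r 0 * z) 1)) => [r|].
  by elim: (r 1) => [|m /= ->]; rewrite ?expn0 ?expnS.
apply: (tot_iteri (g := fun _ z r => r 0 * z)); try exact: tot_var.
  exact: tot_const.
by apply: tot_mul; exact: tot_var.
Qed.

Lemma tot_leq N a b : tot N a -> tot N b -> totb N (fun r => a r <= b r).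
Proof.
move=> ha hb; apply: (@tot_ext _ (fun r => 1 - (a r - b r))) => [r|].
  by rewrite /leq; case: (a r - b r).
by apply: tot_sub; [exact: tot_const | exact: tot_sub].
Qed.

Lemma tot_negb N P : totb N P -> totb N (fun r => ~~ P r).
Proof.
move=> hP; apply: (@tot_ext _ (fun r => 1 - P r)) => [r|]; first by case: (P r).
by apply: tot_sub => //; exact: tot_const.
Qed.

Lemma tot_andb N P Q : totb N P -> totb N Q -> totb N (fun r => P r && Q r).
Proof.
move=> hP hQ; apply: (@tot_ext _ (fun r => P r * Q r)) => [r|].
  by rewrite mulnb.
exact: tot_mul.
Qed.

Lemma tot_orb N P Q : totb N P -> totb N Q -> totb N (fun r => P r || Q r).
Proof.
move=> hP hQ; apply: (@tot_ext _ (fun r => ~~ (~~ P r && ~~ Q r))) => [r|].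
  by rewrite negb_and !negbK.
by apply/tot_negb/tot_andb; exact: tot_negb.
Qed.

Lemma tot_implyb N P Q :
  totb N P -> totb N Q -> totb N (fun r => P r ==> Q r).
Proof.
move=> hP hQ; apply: (@tot_ext _ (fun r => ~~ P r || Q r)) => [r|].
  by rewrite implybE.
by apply: tot_orb => //; exact: tot_negb.
Qed.

Lemma tot_eqn N a b : tot N a -> tot N b -> totb N (fun r => a r == b r).
Proof.
move=> ha hb; apply: (@tot_ext _ (fun r => (a r <= b r) && (b r <= a r))).
  by move=> r; rewrite -eqn_leq.
by apply: tot_andb; exact: tot_leq.
Qed.

Lemma tot_if N P a b : totb N P -> tot N a -> tot N b ->
  tot N (fun r => if P r then a r else b r).
Proof.
move=> hP ha hb; apply: (@tot_ext _ (fun r => P r * a r + (1 - P r) * b r)).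
  by move=> r; case: (P r); rewrite ?mul1n ?mul0n ?addn0.
apply: tot_add; apply: tot_mul => //; apply: tot_sub => //; exact: tot_const.
Qed.

Lemma tot_find N b (P : nat -> (nat -> nat) -> bool) :
  tot N b -> totb N.+1 (fun r => P (r 0) (fun i => r i.+1)) ->
  tot N (fun r => find (P^~ r) (iota 0 (b r))).
Proof.
move=> hb hP.
apply: (@tot_ext _ (fun r => iteri (b r)
  (fun m z => if z < m then z else m + ~~ P m r) 0)) => [r|].
  elim: (b r) => [|m IH] //; have -> : iota 0 m.+1 = iota 0 m ++ [:: m].
    by rewrite -addn1 iotaD.
  rewrite find_cat has_find size_iota /= IH.
  case: ltnP => // h; by case: (P m r).
apply: (tot_iteri (g := fun m z r => if z < m then z else m + ~~ P m r)) => //.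
  exact: tot_const.
apply: tot_if; [apply: tot_leq | exact: tot_var | apply: tot_add].
- by apply: tot_succ; exact: tot_var.
- exact: tot_var.
- exact: tot_var.
apply: tot_negb; pose G i (r : nat -> nat) := if i is j.+1 then r j.+2 else r 0.
have hG i : i < N.+1 -> tot N.+2 (G i) by case: i => *; exact: tot_var.
have [e he] := tot_reindex hP hG.
exists e => xs sxs y; rewrite (he _ sxs) /=.
suff -> : (fun i => if i.+1 < N.+1 then nth 0 xs i.+2 else 0)
  = (fun i => nth 0 xs i.+2) by [].
apply/funext => i; case: ltnP => // h; rewrite nth_default // sxs; lia.
Qed.

Lemma tot_has N b (P : nat -> (nat -> nat) -> bool) :
  tot N b -> totb N.+1 (fun r => P (r 0) (fun i => r i.+1)) ->
  totb N (fun r => has (P^~ r) (iota 0 (b r))).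
Proof.
move=> hb hP; apply: (@tot_ext _
  (fun r => (find (P^~ r) (iota 0 (b r))).+1 <= b r)) => [r|].
  by rewrite has_find size_iota.
by apply: tot_leq => //; apply: tot_succ; exact: tot_find.
Qed.

Lemma tot_all N b (P : nat -> (nat -> nat) -> bool) :
  tot N b -> totb N.+1 (fun r => P (r 0) (fun i => r i.+1)) ->
  totb N (fun r => all (P^~ r) (iota 0 (b r))).
Proof.
move=> hb hP; apply: (@tot_ext _
  (fun r => ~~ has (fun z => ~~ P z r) (iota 0 (b r)))) => [r|].
  by rewrite has_predC negbK.
by apply: tot_negb; apply: (tot_has (P := fun z r => ~~ P z r)) => //;
  exact: tot_negb.
Qed.

Lemma eventually_forall_lt n (P : nat -> nat -> Prop) :
  (forall k s t, s <= t -> P k s -> P k t) ->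
  (forall k, k < n -> exists t, P k t) ->
  exists t, forall k, k < n -> P k t.
Proof.
move=> mono; elim: n => [|n IH] h; first by exists 0.
have [s hs] := IH (fun k kn => h k (ltnW kn)).
have [t ht] := h n (ltnSn n).
exists (maxn s t) => k; rewrite ltnS leq_eqVlt => /predU1P [->|kn].
  exact: mono (leq_maxr _ _) ht.
exact: mono (leq_maxl _ _) (hs k kn).
Qed.

Lemma find_iota_eq (P : pred nat) b y :
  y < b -> P y -> (forall m, m < y -> ~~ P m) -> find P (iota 0 b) = y.
Proof.
move=> yb Py hm; apply/eqP; rewrite eqn_leq; apply/andP; split; rewrite leqNgt.
  by apply/negP => /(before_find 0); rewrite nth_iota // add0n Py.
apply/negP => h.
have hb : find P (iota 0 b) < size (iota 0 b).
  by rewrite size_iota (ltn_trans h).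
have /(nth_find 0) : has P (iota 0 b) by rewrite has_find.
by rewrite (nth_iota _ _ (ltn_trans h yb)) add0n (negPf (hm _ h)).
Qed.

Lemma find_iotaP (P : pred nat) b (y := find P (iota 0 b)) :
  y < b -> P y /\ forall m, m < y -> ~~ P m.
Proof.
move=> yb; split=> [|m my].
  have /(nth_find 0) : has P (iota 0 b) by rewrite has_find size_iota.
  by rewrite nth_iota.
have := before_find 0 my; rewrite nth_iota ?add0n => [-> //|].
exact: ltn_trans yb.
Qed.

Lemma has_iotaP (P : pred nat) b :
  reflect (exists2 m, m < b & P m) (has P (iota 0 b)).
Proof.
by apply: (iffP hasP) => -[m]; rewrite ?mem_iota => h Pm; exists m;
  rewrite ?mem_iota.
Qed.

Lemma all_iotaP (P : pred nat) b :
  reflect (forall m, m < b -> P m) (all P (iota 0 b)).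
Proof.
by apply: (iffP allP) => h m; [move=> mb; apply: h | move=> mb; apply: h];
  move: mb; rewrite mem_iota.
Qed.

(** * Step-bounded evaluation *)

(* The value of e at xs, as far as it can be computed within t steps: y + 1 if
   it is found to be y, and 0 if it is not known yet. *)
Fixpoint ev (e : recfun) (t : nat) (xs : seq nat) {struct e} : nat :=
  match e with
  | Zero => 1
  | Succ => (nth 0 xs 0).+2
  | Proj i => (nth 0 xs i).+1
  | Comp f gs =>
      let ys := map (fun g => ev g t xs) gs in
      if all (ltn 0) ys then ev f t (map predn ys) else 0
  | Prec f g =>
      iteri (head 0 xs)
        (fun m z => if 0 < z then ev g t [:: m, z.-1 & behead xs] else 0)
        (ev f t (behead xs))
  | Mu f =>
      let y := find (fun y => ev f t (y :: xs) <= 1) (iota 0 t) in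
      if (y < t) && (ev f t (y :: xs) == 1) then y.+1 else 0
  end.

Lemma ev_MuP f t xs y :
  ev (Mu f) t xs = y.+1 <->
  [/\ y < t, ev f t (y :: xs) = 1 & forall m, m < y -> 1 < ev f t (m :: xs)].
Proof.
split=> /= [|[yt E hm]].
  case: ifP => // /andP[lt /eqP E] [<-]; split=> // m /(find_iotaP lt).2.
  by rewrite -ltnNge.
by rewrite (@find_iota_eq _ _ y) ?E ?yt // => m /hm; rewrite ltnNge.
Qed.

Lemma ev_mono e s t xs y : s <= t -> ev e s xs = y.+1 -> ev e t xs = y.+1.
Proof.
move=> st; elim/recfun_nested_ind: e xs y => //.
- move=> f gs IHf IHgs xs y /=; case: ifP => // hall Ef.
  suff -> : [seq ev g t xs | g <- gs] = [seq ev g s xs | g <- gs].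
    by rewrite hall; exact: IHf.
  elim: gs IHgs hall {Ef} => //= g gs IH IHgs /andP[gpos hall].
  rewrite IH // => [|g' hg']; last by apply: IHgs; right.
  congr (_ :: _); case E: (ev g s xs) gpos => [//|z] _.
  by apply: IHgs E; left.
- move=> f g IHf IHg xs y /=.
  elim: (head 0 xs) y => [|n IH] y /=; first exact: IHf.
  case: ifP => // pos Eg.
  by rewrite (IH _ (esym (prednK pos))) /=; apply: IHg.
- move=> f IHf xs y /ev_MuP [ys E hm]; apply/ev_MuP; split.
  + exact: leq_trans st.
  + exact: IHf.
  + move=> m /hm; case Em: (ev f s (m :: xs)) => [//|z].
    by rewrite (IHf _ _ Em).
Qed.

Lemma ev_stable e s t xs : s <= t -> 0 < ev e s xs -> ev e t xs = ev e s xs.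
Proof.
by move=> st; case E: (ev e s xs) => [//|y] _; exact: ev_mono st E.
Qed.

Lemma ev_complete e xs y : rec_eval e xs y -> exists t, ev e t xs = y.+1.
Proof.
elim/recfun_nested_ind: e xs y.
- by move=> xs y /= ->; exists 0.
- by move=> xs y /= ->; exists 0.
- by move=> i xs y /= ->; exists 0.
- move=> f gs IHf IHgs xs y /rec_eval_Comp [ys hys /IHf [t ht]].
  have [s hs] : exists s, [seq ev g s xs | g <- gs] = map succn ys.
    elim: gs ys IHgs hys {ht} => [|g gs IH] [|z ys] //= IHgs.
    move=> [/(IHgs _ (or_introl erefl)) [t1 h1]].
    move=> /(IH _ (fun g' hg' => IHgs g' (or_intror hg'))) [t2 h2].
    exists (maxn t1 t2); rewrite (ev_mono (leq_maxl _ _) h1); congr (_ :: _).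
    elim: gs ys h2 {IH IHgs} => [|g' gs IH] [|z' ys] //= [h2 /IH ->].
    by rewrite (ev_mono (leq_maxr _ _) h2).
  exists (maxn s t) => /=.
  have -> : [seq ev g (maxn s t) xs | g <- gs] = map succn ys.
    elim: gs ys hs {IHgs hys ht} => [|g' gs IH] [|z' ys] //= [h2 /IH ->].
    by rewrite (ev_mono (leq_maxl _ _) h2).
  rewrite all_map (eq_all (a2 := xpredT)) // all_predT -map_comp map_id.
  exact: ev_mono (leq_maxr _ _) ht.
- move=> f g IHf IHg xs y /=.
  elim: (head 0 xs) y => [|n IH] y /=; first exact: IHf.
  move=> [z /IH [s hs] /IHg [t ht]]; exists (maxn s t).
  have /= -> := @ev_mono (Prec f g) s _ (n :: behead xs) z (leq_maxl s t) hs.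
  by rewrite /= (ev_mono (leq_maxr _ _) ht).
- move=> f IHf xs y /= [/IHf [s hs] hm].
  have [t ht] : exists t, forall m, m < y -> 1 < ev f t (m :: xs).
    apply: (@eventually_forall_lt y (fun m t => 1 < ev f t (m :: xs))).
      by move=> m t1 t2 t12 h1; rewrite (ev_stable t12) // ltnW.
    by move=> m /hm [z /IHf [t ht]]; exists t; rewrite ht.
  exists (maxn y.+1 (maxn s t)); apply/ev_MuP; split.
  + exact: leq_maxl.
  + by apply: ev_mono hs; rewrite !leq_max leqnn orbT.
  + move=> m /ht h; rewrite (@ev_stable _ t) //; last exact: ltnW.
    by rewrite !leq_max leqnn !orbT.
Qed.

Lemma tot_all_const N m (P : nat -> (nat -> nat) -> bool) :
  (forall i, totb N (P i)) -> totb N (fun r => all (P^~ r) (iota 0 m)).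
Proof.
move=> hP; elim: m => [|m IH]; first exact: (tot_const _ 1).
apply: (@tot_ext _ (fun r => all (P^~ r) (iota 0 m) && P m r)) => [r|].
  by rewrite -[in RHS]addn1 iotaD all_cat /= andbT.
exact: tot_andb.
Qed.

Lemma mkseqS (f : nat -> nat) n :
  mkseq f n.+1 = f 0 :: mkseq (fun i => f i.+1) n.
Proof. by rewrite /mkseq /= -add1n iotaDl -map_comp. Qed.

Lemma tot_ev_args e m N a (G : nat -> (nat -> nat) -> nat) :
  tot m.+1 (fun r => ev e (r 0) (mkseq (fun i => r i.+1) m)) ->
  tot N a -> (forall i, i < m -> tot N (G i)) ->
  tot N (fun r => ev e (a r) (mkseq (G^~ r) m)).
Proof.
move=> he ha hG; pose H i := if i is j.+1 then G j else a.
have hH i : i < m.+1 -> tot N (H i) by case: i.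
apply: tot_ext (tot_reindex he hH) => r /=; congr ev.
by apply/eq_in_map => i; rewrite mem_iota ltnS => /andP[_ ->].
Qed.

Lemma tot_ev e N : tot N.+1 (fun r => ev e (r 0) (mkseq (fun i => r i.+1) N)).
Proof.
elim/recfun_nested_ind: e N.
- by move=> N; exact: tot_const.
- case=> [|N]; first exact: (tot_const _ 2).
  by do 2 apply: tot_succ; exact: tot_var.
- move=> i N; apply: tot_succ; case: (ltnP i N) => h.
    apply: (@tot_ext _ (fun r => r i.+1)) => [r|]; last exact: tot_var.
    by rewrite nth_mkseq.
  apply: (@tot_ext _ (fun=> 0)) => [r|]; last exact: tot_const.
  by rewrite nth_default // size_mkseq.
- move=> f gs IHf IHgs N /=.
  pose xs N (r : nat -> nat) := mkseq (fun i => r i.+1) N.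
  pose v i r := nth 0 (map (fun g => ev g (r 0) (xs N r)) gs) i.
  have hv i : tot N.+1 (v i).
    rewrite /v; elim: gs IHgs i {v} => [|g gs IH] IHgs i.
      by apply: (@tot_ext _ (fun=> 0)) => [r|]; [case: i | exact: tot_const].
    case: i => [|i] /=; first by apply: IHgs; left.
    by apply: IH => g' hg'; apply: IHgs; right.
  pose m := size gs.
  apply: (@tot_ext _ (fun r => if all (fun i => 0 < v i r) (iota 0 m) then
      ev f (r 0) (mkseq (fun i => (v i r).-1) m) else 0)) => [r|].
    set ys := map _ gs.
    have Eys : mkseq (v^~ r) m = ys by rewrite -[RHS](mkseq_nth 0) size_map.
    by rewrite -Eys !all_map -map_comp.
  apply: tot_if; last exact: tot_const.
    apply: (tot_all_const _ (P := fun i r => 0 < v i r)) => i.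
    by apply: tot_leq; first exact: tot_const.
  apply: tot_ev_args => //; first exact: tot_var.
  by move=> i _; exact: tot_pred.
- move=> f g IHf IHg [|N].
    apply: (@tot_ext _ (fun r => ev f (r 0) (mkseq (fun i => r i.+1) 0))) => //.
  apply: (@tot_ext _ (fun r => iteri (r 1) (fun m z => if 0 < z
    then ev g (r 0) (mkseq (fun i => if i is i'.+1 then if i' is j.+1
      then r j.+2 else z.-1 else m) N.+2) else 0)
    (ev f (r 0) (mkseq (fun i => r i.+2) N)))) => [r|].
    rewrite mkseqS [RHS]/=; congr iteri.
    by apply/funext => m; apply/funext => z; rewrite !mkseqS.
  apply: (tot_iteri (g := fun m z r => if 0 < z
    then ev g (r 0) (mkseq (fun i => if i is i'.+1 then if i' is j.+1
      then r j.+2 else z.-1 else m) N.+2) else 0)); first exact: tot_var.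
    apply: tot_ev_args => //; first exact: tot_var.
    by move=> i _; exact: tot_var.
  apply: tot_if; last exact: tot_const.
    by apply: tot_leq; [exact: tot_const | exact: tot_var].
  apply: tot_ev_args (IHg _) _ _ => //; first exact: tot_var.
  by case=> [|[|i]] _; [| apply: tot_pred |]; exact: tot_var.
- move=> f IHf N.
  pose Q y (r : nat -> nat) := ev f (r 0)
    (mkseq (fun i => if i is j.+1 then r j.+1 else y) N.+1).
  have hQ M y s : tot M y -> (forall i, tot M (s i)) ->
      tot M (fun r => Q (y r) (fun i => s i r)).
    by move=> hy hs; apply: tot_ev_args => // -[].
  have E r y : ev f (r 0) (y :: mkseq (fun i => r i.+1) N) = Q y r.
    by rewrite /Q mkseqS.
  apply: (@tot_ext _ (fun r =>
    let y := find (fun y => Q y r <= 1) (iota 0 (r 0)) in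
    if (y < r 0) && (Q y r == 1) then y.+1 else 0)) => [r /=|].
    have -> : (fun y => Q y r <= 1) =
        (fun y => ev f (r 0) (y :: mkseq (fun i => r i.+1) N) <= 1).
      by apply/funext => y; rewrite E.
    by rewrite -E.
  have hfind : tot N.+1 (fun r => find (fun y => Q y r <= 1) (iota 0 (r 0))).
    apply: (tot_find (P := fun y r => Q y r <= 1)); first exact: tot_var.
    apply: tot_leq; last exact: tot_const.
    by apply: (hQ N.+2 (fun r => r 0) (fun i r => r i.+1)) => *; exact: tot_var.
  apply: tot_if; last exact: tot_const; last exact: tot_succ.
  apply: tot_andb; first by apply: tot_leq; [exact: tot_succ | exact: tot_var].
  apply: tot_eqn; last exact: tot_const.
  by apply: (hQ N.+1 _ (fun i r => r i)) => // i; exact: tot_var.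
Qed.

Lemma tot_div N a b : tot N a -> tot N b -> tot N (fun r => a r %/ b r).
Proof.
move=> ha hb; apply: (@tot_ext _ (fun r => if b r == 0 then 0 else
    find (fun q => a r < q.+1 * b r) (iota 0 (a r).+1))) => [r|].
  case: eqVneq => [->|b0]; first by rewrite divn0.
  apply: find_iota_eq.
  - by rewrite ltnS leq_div.
  - by rewrite ltn_ceil // lt0n.
  - move=> m lt_m; rewrite -leqNgt (leq_trans _ (leq_trunc_div _ (b r))) //.
    by rewrite leq_mul2r lt_m orbT.
apply: tot_if; [by apply: tot_eqn; last exact: tot_const | exact: tot_const |].
apply: (tot_find (P := fun q r => a r < q.+1 * b r)); first exact: tot_succ.
have shift f : tot N f -> tot N.+1 (fun r => f (fun i => r i.+1)).
  move=> hf; pose G i (r : nat -> nat) := r i.+1.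
  have [e he] := @tot_reindex N N.+1 f G hf (fun i _ => tot_var _ _).
  exists e => xs sxs y; rewrite (he _ sxs).
  suff -> : (fun i => if i < N then G i (nth 0 xs) else 0) =
      (fun i => nth 0 xs i.+1) by [].
  by apply/funext => i; case: ltnP => // h; rewrite nth_default // sxs.
apply: tot_leq; first by apply: tot_succ; exact: shift.
by apply: tot_mul; [apply: tot_succ; exact: tot_var | exact: shift].
Qed.

Lemma tot_mod N a b : tot N a -> tot N b -> tot N (fun r => a r %% b r).
Proof.
move=> ha hb; apply: (@tot_ext _ (fun r => a r - a r %/ b r * b r)) => [r|].
  by rewrite {1}(divn_eq (a r) (b r)) addKn.
by apply: tot_sub => //; apply: tot_mul => //; exact: tot_div.
Qed.

(* Redefined below, to apply the lemmas of the hint database tot. *)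
Ltac tot_user := fail.

Ltac tot1 := cbv beta; lazymatch goal with
  | |- tot _ (fun _ => ?c) => exact: (tot_const _ c)
  | |- tot _ (fun r => S (@?a r)) => apply: (@tot_succ _ a)
  | |- tot _ (fun r => predn (@?a r)) => apply: (@tot_pred _ a)
  | |- tot _ (fun r => addn (@?a r) (@?b r)) => apply: (@tot_add _ a b)
  | |- tot _ (fun r => subn (@?a r) (@?b r)) => apply: (@tot_sub _ a b)
  | |- tot _ (fun r => muln (@?a r) (@?b r)) => apply: (@tot_mul _ a b)
  | |- tot _ (fun r => expn (@?a r) (@?b r)) => apply: (@tot_exp _ a b)
  | |- tot _ (fun r => divn (@?a r) (@?b r)) => apply: (@tot_div _ a b)
  | |- tot _ (fun r => modn (@?a r) (@?b r)) => apply: (@tot_mod _ a b)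
  | |- tot _ (fun r => nat_of_bool (leq (@?a r) (@?b r))) =>
      apply: (@tot_leq _ a b)
  | |- tot _ (fun r => nat_of_bool (@?a r == @?b r)) =>
      apply: (@tot_eqn _ a b)
  | |- tot _ (fun r => nat_of_bool (@?a r && @?b r)) =>
      apply: (@tot_andb _ a b)
  | |- tot _ (fun r => nat_of_bool (@?a r || @?b r)) =>
      apply: (@tot_orb _ a b)
  | |- tot _ (fun r => nat_of_bool (@?a r ==> @?b r)) =>
      apply: (@tot_implyb _ a b)
  | |- tot _ (fun r => nat_of_bool (~~ @?a r)) =>
      apply: (@tot_negb _ a)
  | |- tot _ (fun r => nat_of_bool (has (fun z => @?P r z) (iota 0 (@?b r)))) =>
      refine (@tot_has _ b (fun z r => P r z) _ _)
  | |- tot _ (fun r => nat_of_bool (all (fun z => @?P r z) (iota 0 (@?b r)))) =>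
      refine (@tot_all _ b (fun z r => P r z) _ _)
  | |- tot _ (fun r => find (fun z => @?P r z) (iota 0 (@?b r))) =>
      refine (@tot_find _ b (fun z r => P r z) _ _)
  | |- tot _ (fun r => iteri (@?b r) (fun m z => @?g r m z) (@?f r)) =>
      refine (@tot_iteri _ b f (fun m z r => g r m z) _ _ _)
  | |- _ => first [tot_user | exact: tot_var | apply: tot_if]
  end.

Ltac tot := repeat tot1.

(** * The enumeration process *)

(* The parameters n, epsilon (rounded up), m, w, l, a, M of the process, in this
   order; the machine that lists the blocks contributes at most i to w. *)
Definition str_len (i : nat) : nat := 2 ^ 2 ^ i.
Definition eps_up (i : nat) : nat := (str_len i %/ (10 * 2 ^ i)).+1.
Definition log_len (i : nat) : nat := str_len i %/ 4.
Definition window (i : nat) : nat := 3 * i + 2.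
Definition levels (i : nat) : nat := 3 * i + 5.
Definition gap (i : nat) : nat := 3 * eps_up i.
Definition log_size (i : nat) : nat := log_len i + window i + 3 * eps_up i + 1.
Definition threshold (i d : nat) : nat := d * gap i + window i + eps_up i.
(* Dominates alpha + epsilon for the thresholds alpha = theta_e with e <= d, at
   which level d requires the answer 0. *)
Definition cover_level (i d : nat) : nat := threshold i d + eps_up i.
Definition log_block (i d : nat) : nat := log_len i - d.+1 * gap i.

Lemma tot_str_len : tot 1 (fun r => str_len (r 0)).
Proof. by rewrite /str_len; tot. Qed.

Create HintDb tot.
#[local] Hint Resolve tot_str_len : tot.

Ltac tot_known := cbv beta; solve [trivial with tot].

Ltac tot_user ::= match goal with
  | |- tot _ (fun r => nat_of_bool (?f (@?a r) (@?b r) (@?c r) (@?d r))) =>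
      refine (@tot_app4 _ (fun x y z t => nat_of_bool (f x y z t)) a b c d
        _ _ _ _ _);
      [tot_known | | | |]
  | |- tot _ (fun r => nat_of_bool (?f (@?a r) (@?b r) (@?c r))) =>
      refine (@tot_app3 _ (fun x y z => nat_of_bool (f x y z)) a b c _ _ _ _);
      [tot_known | | |]
  | |- tot _ (fun r => ?f (@?a r) (@?b r) (@?c r) (@?d r)) =>
      apply: (@tot_app4 _ f a b c d); [tot_known | | | |]
  | |- tot _ (fun r => ?f (@?a r) (@?b r) (@?c r)) =>
      apply: (@tot_app3 _ f a b c); [tot_known | | |]
  | |- tot _ (fun r => ?f (@?a r) (@?b r)) =>
      apply: (@tot_app2 _ f a b); [tot_known | |]
  | |- tot _ (fun r => ?f (@?a r)) =>
      apply: (@tot_app1 _ f a); [tot_known |]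
  end.

Lemma tot_eps_up : tot 1 (fun r => eps_up (r 0)).
Proof. by rewrite /eps_up; tot. Qed.
#[local] Hint Resolve tot_eps_up : tot.

Lemma tot_log_len : tot 1 (fun r => log_len (r 0)).
Proof. by rewrite /log_len; tot. Qed.
#[local] Hint Resolve tot_log_len : tot.

Lemma tot_window : tot 1 (fun r => window (r 0)).
Proof. by rewrite /window; tot. Qed.
#[local] Hint Resolve tot_window : tot.

Lemma tot_levels : tot 1 (fun r => levels (r 0)).
Proof. by rewrite /levels; tot. Qed.
#[local] Hint Resolve tot_levels : tot.

Lemma tot_gap : tot 1 (fun r => gap (r 0)).
Proof. by rewrite /gap; tot. Qed.
#[local] Hint Resolve tot_gap : tot.

Lemma tot_log_size : tot 1 (fun r => log_size (r 0)).
Proof. by rewrite /log_size; tot. Qed.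
#[local] Hint Resolve tot_log_size : tot.

Lemma tot_threshold : tot 2 (fun r => threshold (r 0) (r 1)).
Proof. by rewrite /threshold; tot. Qed.
#[local] Hint Resolve tot_threshold : tot.

Lemma tot_cover_level : tot 2 (fun r => cover_level (r 0) (r 1)).
Proof. by rewrite /cover_level; tot. Qed.
#[local] Hint Resolve tot_cover_level : tot.

Lemma tot_log_block : tot 2 (fun r => log_block (r 0) (r 1)).
Proof. by rewrite /log_block; tot. Qed.
#[local] Hint Resolve tot_log_block : tot.

(* The following functions decode [listing l] on codes of strings: sd_cons
   prepends a self-delimiting code, sd_head and sd_tail undo this (with junk
   values on strings that do not start with such a code). *)
Definition code_size (x : nat) : nat :=
  find (fun k => x.+1 < 2 ^ k.+1) (iota 0 x.+1).

Definition sd_cons (x r : nat) : nat :=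
  2 * (2 ^ code_size x - 1)
  + 2 ^ code_size x * (1 + 2 * (x + 2 ^ code_size x * r)).

Definition sd_head (y : nat) : nat :=
  find (fun x => has (fun r => sd_cons x r == y) (iota 0 y.+1)) (iota 0 y.+1).

Definition sd_tail (y : nat) : nat :=
  find (fun r => has (fun x => sd_cons x r == y) (iota 0 y.+1)) (iota 0 y.+1).

Definition sd_drop (j y : nat) : nat := iteri j (fun _ z => sd_tail z) y.

Lemma tot_code_size : tot 1 (fun r => code_size (r 0)).
Proof. by rewrite /code_size; tot. Qed.
#[local] Hint Resolve tot_code_size : tot.

Lemma tot_sd_cons : tot 2 (fun r => sd_cons (r 0) (r 1)).
Proof. by rewrite /sd_cons; tot. Qed.
#[local] Hint Resolve tot_sd_cons : tot.

Lemma tot_sd_head : tot 1 (fun r => sd_head (r 0)).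
Proof. by rewrite /sd_head; tot. Qed.
#[local] Hint Resolve tot_sd_head : tot.

Lemma tot_sd_tail : tot 1 (fun r => sd_tail (r 0)).
Proof. by rewrite /sd_tail; tot. Qed.
#[local] Hint Resolve tot_sd_tail : tot.

Lemma tot_sd_drop : tot 2 (fun r => sd_drop (r 0) (r 1)).
Proof. by rewrite /sd_drop; tot. Qed.
#[local] Hint Resolve tot_sd_drop : tot.

Definition ev1 (U : recfun) (t p : nat) : nat := ev U t [:: p].

Definition ev3 (A : recfun) (t x k al : nat) : nat := ev A t [:: x; k; al].

Lemma tot_ev1 U : tot 2 (fun r => ev1 U (r 0) (r 1)).
Proof. exact: (tot_ev U 1). Qed.
#[local] Hint Resolve tot_ev1 : tot.

Lemma tot_ev3 A : tot 4 (fun r => ev3 A (r 0) (r 1) (r 2) (r 3)).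
Proof. exact: (tot_ev A 3). Qed.
#[local] Hint Resolve tot_ev3 : tot.

(* x is among the first 2^M elements of the list that p outputs within t steps;
   the cutoff keeps the test sound for counting and is harmless, as larger sets
   are of no concern. *)
Definition listed (U : recfun) (p t i x : nat) : bool :=
  (0 < ev1 U t p) &&
  has (fun j => sd_head (sd_drop j (ev1 U t p).-1) == x)
    (iota 0 (2 ^ log_size i)).

Definition covered (U : recfun) (c t i x : nat) : bool :=
  has (fun p => listed U p t i x) (iota 0 (2 ^ c.+1)).

Definition low_K (U : recfun) (t i x : nat) : bool :=
  has (fun p => ev1 U t p == x.+1) (iota 0 (2 ^ (log_len i).-1)).

(* [ev3] returns the answer of A plus one. *)
Definition commits (A : recfun) (t i d x : nat) : bool :=
  has (fun k => all (fun d' =>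
      ev3 A t x ((log_len i).-1 + k) (threshold i d') == 1 + (d < d'))
    (iota 0 (levels i).+1))
  (iota 0 (window i + 2)).

Definition settled (U A : recfun) (t i d x : nat) : bool :=
  low_K U t i x || (covered U (cover_level i d) t i x || commits A t i d x).

(* The history x_0, x_1, ... is the number with digits x_u in base 2^(n+1); the
   codes of strings of length n are nonzero, so the digit 0 marks the end. *)
Definition digit (i h u : nat) : nat :=
  h %/ (2 ^ (str_len i).+1) ^ u %% 2 ^ (str_len i).+1.

Definition history_size (i h : nat) : nat :=
  find (fun u => digit i h u == 0) (iota 0 (2 ^ log_len i)).

Definition used (i h x : nat) : bool :=
  has (fun u => digit i h u == x) (iota 0 (2 ^ log_len i)).

Definition fresh (U : recfun) (t i h : nat) : nat :=
  2 ^ str_len i - 1 + find (fun q => ~~ used i h (2 ^ str_len i - 1 + q) &&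
      ~~ covered U (cover_level i (levels i)) t i (2 ^ str_len i - 1 + q))
    (iota 0 (2 ^ str_len i)).

Definition unblocked (U A : recfun) (t i h : nat) : bool :=
  all (fun v => all (fun d =>
      (v %/ 2 ^ log_block i d < history_size i h %/ 2 ^ log_block i d) ==>
      settled U A t i d (digit i h v)) (iota 0 (levels i)))
    (iota 0 (history_size i h)).

Definition extend (U A : recfun) (t i h : nat) : nat :=
  if (history_size i h < 2 ^ log_len i) && unblocked U A t i h
  then h + fresh U t i h * (2 ^ (str_len i).+1) ^ history_size i h else h.

Definition history (U A : recfun) (t i : nat) : nat :=
  iteri t (fun s h => extend U A s i h) 0.

Lemma tot_listed U : tot 4 (fun r => listed U (r 0) (r 1) (r 2) (r 3)).
Proof. by rewrite /listed; tot. Qed.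
#[local] Hint Resolve tot_listed : tot.

Lemma tot_covered U : tot 4 (fun r => covered U (r 0) (r 1) (r 2) (r 3)).
Proof. by rewrite /covered; tot. Qed.
#[local] Hint Resolve tot_covered : tot.

Lemma tot_low_K U : tot 3 (fun r => low_K U (r 0) (r 1) (r 2)).
Proof. by rewrite /low_K; tot. Qed.
#[local] Hint Resolve tot_low_K : tot.

Lemma tot_commits A : tot 4 (fun r => commits A (r 0) (r 1) (r 2) (r 3)).
Proof. by rewrite /commits; tot. Qed.
#[local] Hint Resolve tot_commits : tot.

Lemma tot_settled U A : tot 4 (fun r => settled U A (r 0) (r 1) (r 2) (r 3)).
Proof. by rewrite /settled; tot. Qed.
#[local] Hint Resolve tot_settled : tot.

Lemma tot_digit : tot 3 (fun r => digit (r 0) (r 1) (r 2)).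
Proof. by rewrite /digit; tot. Qed.
#[local] Hint Resolve tot_digit : tot.

Lemma tot_history_size : tot 2 (fun r => history_size (r 0) (r 1)).
Proof. by rewrite /history_size; tot. Qed.
#[local] Hint Resolve tot_history_size : tot.

Lemma tot_used : tot 3 (fun r => used (r 0) (r 1) (r 2)).
Proof. by rewrite /used; tot. Qed.
#[local] Hint Resolve tot_used : tot.

Lemma tot_fresh U : tot 3 (fun r => fresh U (r 0) (r 1) (r 2)).
Proof. by rewrite /fresh; tot. Qed.
#[local] Hint Resolve tot_fresh : tot.

Lemma tot_unblocked U A : tot 3 (fun r => unblocked U A (r 0) (r 1) (r 2)).
Proof. by rewrite /unblocked; tot. Qed.
#[local] Hint Resolve tot_unblocked : tot.

Lemma tot_step U A : tot 3 (fun r => extend U A (r 0) (r 1) (r 2)).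
Proof. by rewrite /extend; tot. Qed.
#[local] Hint Resolve tot_step : tot.

Lemma tot_history U A : tot 2 (fun r => history U A (r 0) (r 1)).
Proof. by rewrite /history; tot. Qed.
#[local] Hint Resolve tot_history : tot.

(** * String codes *)

Lemma string_code_inj : injective string_code.
Proof. exact: bij_inj string_code_bij. Qed.

Lemma string_code_surj n : exists s, string_code s = n.
Proof. by have [g _ gK] := string_code_bij; exists (g n). Qed.

Lemma string_code_cat s t :
  string_code (s ++ t) = string_code s + 2 ^ size s * string_code t.
Proof.
elim: s => [|b s IH]; first by rewrite mul1n.
by rewrite [LHS]/= -/(string_code _) IH /= -/(string_code _) expnS; lia.
Qed.

Lemma string_code_bounds s :
  2 ^ size s <= (string_code s).+1 < 2 ^ (size s).+1.
Proof.
elim: s => [//|b s /andP[lo hi]].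
rewrite /= -/(string_code _) !expnS in lo hi *; case: b => /=; lia.
Qed.

Lemma string_code_nseq_true m : string_code (nseq m true) = 2 * (2 ^ m - 1).
Proof.
by elim: m => [//|m IH]; rewrite /= -/(string_code _) IH expnS; lia.
Qed.

Lemma code_sizeE s : code_size (string_code s) = size s.
Proof.
have /andP[lo hi] := string_code_bounds s.
apply: find_iota_eq => // [|m ms].
  by rewrite (leq_trans _ lo) // ltn_expl.
rewrite -leqNgt (leq_trans _ lo) // leq_exp2l //.
Qed.

Lemma sd_consE x r :
  sd_cons (string_code x) (string_code r) = string_code (selfdelim x ++ r).
Proof.
rewrite /sd_cons code_sizeE /selfdelim -catA string_code_cat.
rewrite string_code_nseq_true size_nseq /= -/(string_code _) string_code_cat.
by congr (_ + _ * _); lia.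
Qed.

Lemma unary_cat_inj i j (s t : bitstring) :
  nseq i true ++ false :: s = nseq j true ++ false :: t -> i = j /\ s = t.
Proof.
elim: i j => [|i IH] [|j] //=; first by case.
by case=> /IH [-> ->].
Qed.

Lemma selfdelim_cat_inj x y r s :
  selfdelim x ++ r = selfdelim y ++ s -> x = y /\ r = s.
Proof.
rewrite /selfdelim -!catA /= => /unary_cat_inj [sxy] /eqP.
by rewrite eqseq_cat // => /andP[/eqP -> /eqP ->].
Qed.

Lemma sd_cons_inj x y r s : sd_cons x r = sd_cons y s -> x = y /\ r = s.
Proof.
have [x' <-] := string_code_surj x; have [y' <-] := string_code_surj y.
have [r' <-] := string_code_surj r; have [s' <-] := string_code_surj s.
by rewrite !sd_consE => /string_code_inj /selfdelim_cat_inj [-> ->].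
Qed.

Lemma sd_cons_geq x r : x <= sd_cons x r /\ r <= sd_cons x r.
Proof.
rewrite /sd_cons; have := expn_gt0 2 (code_size x).
move: (2 ^ _) => k /= k0; have := leq_pmull (1 + 2 * (x + k * r)) k0.
have := leq_pmull r k0; lia.
Qed.

Lemma sd_headE x r : sd_head (sd_cons x r) = x.
Proof.
have [xle rle] := sd_cons_geq x r.
apply: find_iota_eq => //; first by apply/has_iotaP; exists r.
move=> m mx; apply/negP => /has_iotaP [s _ /eqP /sd_cons_inj [E _]].
by rewrite E ltnn in mx.
Qed.

Lemma sd_tailE x r : sd_tail (sd_cons x r) = r.
Proof.
have [xle rle] := sd_cons_geq x r.
apply: find_iota_eq => //; first by apply/has_iotaP; exists x.
move=> m mr; apply/negP => /has_iotaP [s _ /eqP /sd_cons_inj [_ E]].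
by rewrite E ltnn in mr.
Qed.

Lemma sd_dropE l j : j <= size l ->
  sd_drop j (string_code (listing l)) = string_code (listing (drop j l)).
Proof.
elim: j => [|j IH] jl; first by rewrite drop0.
rewrite /sd_drop /= -/(sd_drop _ _) IH; last exact: ltnW.
by rewrite (drop_nth [::] jl) /listing /= -sd_consE sd_tailE.
Qed.

Lemma sd_head_drop l j : j < size l ->
  sd_head (sd_drop j (string_code (listing l))) = string_code (nth [::] l j).
Proof.
move=> jl; rewrite sd_dropE; last exact: ltnW.
by rewrite (drop_nth [::] jl) /listing /= -sd_consE sd_headE.
Qed.

(** * Machines with self-delimiting programs *)

Fixpoint binary (m q : nat) : bitstring :=
  if m is m'.+1 then odd q :: binary m' q./2 else [::].

Lemma size_binary m q : size (binary m q) = m.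
Proof. by elim: m q => //= m IH q; rewrite IH. Qed.

Lemma string_code_binary m q : q < 2 ^ m ->
  string_code (binary m q) = 2 ^ m - 1 + q.
Proof.
elim: m q => [|m IH] q; first by case: q.
rewrite expnS /= -/(string_code _) => qm; rewrite IH; last lia.
have := expn_gt0 2 m; lia.
Qed.

Lemma binary_inj m q r : q < 2 ^ m -> r < 2 ^ m ->
  binary m q = binary m r -> q = r.
Proof.
move=> qm rm /(congr1 string_code); rewrite !string_code_binary //; lia.
Qed.

Definition prog (i d n v : nat) : bitstring :=
  nseq i true ++ false :: binary i d ++ binary n v.

Definition prog_code (i d n v : nat) : nat :=
  2 * (2 ^ i - 1)
  + 2 ^ i * (1 + 2 * (2 ^ i - 1 + d + 2 ^ i * (2 ^ n - 1 + v))).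

Lemma size_prog i d n v : size (prog i d n v) = 2 * i + n + 1.
Proof. by rewrite size_cat /= size_cat size_nseq !size_binary; lia. Qed.

Lemma string_code_prog i d n v : d < 2 ^ i -> v < 2 ^ n ->
  string_code (prog i d n v) = prog_code i d n v.
Proof.
move=> di vn; rewrite string_code_cat string_code_nseq_true size_nseq /=.
rewrite -/(string_code _) string_code_cat size_binary !string_code_binary //.
by congr (_ + _ * _); lia.
Qed.

Lemma prefix_prog (len : nat -> nat -> nat) i d v j e w :
  d < 2 ^ i -> e < 2 ^ j -> v < 2 ^ len i d -> w < 2 ^ len j e ->
  prefix (prog i d (len i d) v) (prog j e (len j e) w) ->
  [/\ i = j, d = e & v = w].
Proof.
move=> di ej vi wj /prefixP [r]; rewrite /prog -catA /= => /esym.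
move=> /unary_cat_inj [ij]; rewrite -ij in ej wj * => /eqP.
rewrite -catA eqseq_cat ?size_binary // => /andP[/eqP /binary_inj de].
rewrite -de // in wj * => /eqP E.
have r0 : r = [::].
  move: (congr1 size E); rewrite size_cat !size_binary; case: (r) => //=; lia.
by move: E; rewrite r0 cats0 => /binary_inj ->.
Qed.

Definition parses (len : nat -> nat -> nat) (c i d v : nat) : bool :=
  (d < 2 ^ i) && (v < 2 ^ len i d) && (prog_code i d (len i d) v == c).

Definition parse_i (len : nat -> nat -> nat) (c : nat) : nat :=
  find (fun i => has (fun d => has (fun v => parses len c i d v)
    (iota 0 c.+1)) (iota 0 c.+1)) (iota 0 c.+1).

Definition parse_d (len : nat -> nat -> nat) (c : nat) : nat :=
  find (fun d => has (fun v => parses len c (parse_i len c) d v)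
    (iota 0 c.+1)) (iota 0 c.+1).

Definition parse_v (len : nat -> nat -> nat) (c : nat) : nat :=
  find (fun v => parses len c (parse_i len c) (parse_d len c) v) (iota 0 c.+1).

Lemma prog_code_geq i d n v :
  [/\ i <= prog_code i d n v, d <= prog_code i d n v & v <= prog_code i d n v].
Proof.
rewrite /prog_code; have hi : i < 2 ^ i by rewrite ltn_expl.
have := expn_gt0 2 n; move: (2 ^ i) (2 ^ n) hi => I N hi /= N0.
have I0 : 0 < I by case: I hi.
have := leq_pmull (1 + 2 * (I - 1 + d + I * (N - 1 + v))) I0.
have := leq_pmull (N - 1 + v) I0.
by split; lia.
Qed.

Lemma parsesE len i d v c : parses len c i d v ->
  [/\ parse_i len c = i, parse_d len c = d & parse_v len c = v].
Proof.
move=> par; have uniq j e w : parses len c j e w -> [/\ j = i, e = d & w = v].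
  move: par => /andP[/andP[di vl] /eqP <-] /andP[/andP[ej wl] /eqP].
  rewrite -!string_code_prog // => /string_code_inj E.
  by apply: (prefix_prog (len := len)); rewrite ?E ?prefix_refl.
have [ic dc vc] : [/\ i < c.+1, d < c.+1 & v < c.+1].
  by move: par => /andP[_ /eqP <-]; exact: prog_code_geq.
have Ei : parse_i len c = i.
  apply: find_iota_eq => //.
    by apply/has_iotaP; exists d => //; apply/has_iotaP; exists v.
  move=> m mi; apply/negP => /has_iotaP [e _ /has_iotaP [w _ /uniq [E _ _]]].
  by rewrite E ltnn in mi.
have Ed : parse_d len c = d.
  apply: find_iota_eq => //; first by rewrite Ei; apply/has_iotaP; exists v.
  move=> m md; apply/negP => /has_iotaP [w _ /uniq [_ E _]].
  by rewrite E ltnn in md.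
split=> //; apply: find_iota_eq => //; first by rewrite Ei Ed.
by move=> m mv; apply/negP => /uniq [_ _ E]; rewrite E ltnn in mv.
Qed.

Lemma tot_parses len : tot 2 (fun r => len (r 0) (r 1)) ->
  tot 4 (fun r => parses len (r 0) (r 1) (r 2) (r 3)).
Proof.
by move=> tot_len; rewrite /parses /prog_code; tot;
  exact: (tot_app2 tot_len); tot.
Qed.

Lemma tot_parse_i len : tot 2 (fun r => len (r 0) (r 1)) ->
  tot 1 (fun r => parse_i len (r 0)).
Proof. by move=> /tot_parses hp; rewrite /parse_i; tot. Qed.

Lemma tot_parse_d len : tot 2 (fun r => len (r 0) (r 1)) ->
  tot 1 (fun r => parse_d len (r 0)).
Proof.
by move=> h; have hp := tot_parses h; have hi := tot_parse_i h;
  rewrite /parse_d; tot.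
Qed.

Lemma tot_parse_v len : tot 2 (fun r => len (r 0) (r 1)) ->
  tot 1 (fun r => parse_v len (r 0)).
Proof.
by move=> h; have hp := tot_parses h; have hi := tot_parse_i h;
  have hd := tot_parse_d h; rewrite /parse_v; tot.
Qed.

Lemma prefix_machine_exists (len : nat -> nat -> nat)
    (ready : nat -> nat -> nat -> nat -> bool)
    (out : nat -> nat -> nat -> nat -> nat) :
  tot 2 (fun r => len (r 0) (r 1)) ->
  tot 4 (fun r => ready (r 0) (r 1) (r 2) (r 3)) ->
  tot 4 (fun r => out (r 0) (r 1) (r 2) (r 3)) ->
  (forall s t i d v, s <= t -> ready s i d v -> out t i d v = out s i d v) ->
  exists2 e, prefix_machine e & forall t i d v,
    d < 2 ^ i -> v < 2 ^ len i d -> ready t i d v ->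
    rec_eval e [:: string_code (prog i d (len i d) v)] (out t i d v).
Proof.
move=> tot_len hready hout stable.
have hp := tot_parses tot_len; have hi := tot_parse_i tot_len.
have hd := tot_parse_d tot_len; have hv := tot_parse_v tot_len.
pose accept c t := parses len c (parse_i len c) (parse_d len c) (parse_v len c)
  && ready t (parse_i len c) (parse_d len c) (parse_v len c).
pose result c t := out t (parse_i len c) (parse_d len c) (parse_v len c).
have [f hf] : tot 2 (fun r => ~~ accept (r 1) (r 0)) by rewrite /accept; tot.
have [g hg] : tot 2 (fun r => result (r 0) (r 1)) by rewrite /result; tot.
pose e := Comp g [:: Proj 0; Mu f].
have Mu_f c t : rec_eval (Mu f) [:: c] t <->
    accept c t /\ forall s, s < t -> ~~ accept c s.
  split=> [[/hf H1 H2]|[H1 H2]].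
    split=> [|s /H2 [z]]; first by move: (H1 erefl) => /=; case: (accept c t).
    by move=> /(hf [:: s; c] erefl) /=; case: (accept c s).
  split=> [|s /H2 H3]; first by apply/(hf [:: t; c] erefl); rewrite /= H1.
  by exists 0; apply/(hf [:: s; c] erefl); rewrite /= H3.
exists e => [p q y z|t i d v di vl rd].
  have parsed x o : runs e x o ->
      exists i d v, [/\ d < 2 ^ i, v < 2 ^ len i d & x = prog i d (len i d) v].
    rewrite /runs /e => /rec_eval_Comp [ys hys _].
    have [t /Mu_f [acc _]] : exists t, rec_eval (Mu f) [:: string_code x] t.
      by case: ys hys => [//|c [[_ []]|t ys [_ [ht _]]]]; exists t.
    do 3 eexists; move: acc => /andP[/andP[/andP[h1 h2] /eqP h3] _].
    split; [exact: h1 | exact: h2 |].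
    by apply: string_code_inj; rewrite string_code_prog.
  move=> /parsed [i [d [v [h1 h2 ->]]]] /parsed [j [d' [v' [h3 h4 ->]]]].
  by move=> /(prefix_prog h1 h3 h2 h4) [-> -> ->].
set c := string_code _.
have par : parses len c i d v.
  by rewrite /parses di vl /= /c string_code_prog.
have [Ei Ed Ev] := parsesE par.
have acc : exists s, accept c s by exists t; rewrite /accept Ei Ed Ev par.
case: (ex_minnP acc) => s acc_s mins.
apply/rec_eval_Comp; exists [:: c; s].
  split=> //; split=> //; apply/Mu_f; split=> // s' ss'.
  by apply/negP => /mins; rewrite leqNgt ss'.
apply/(hg [:: c; s] erefl); rewrite /result /= Ei Ed Ev.
move: acc_s; rewrite /accept Ei Ed Ev => /andP[_ rds].
apply: stable => //; apply: mins; rewrite /accept Ei Ed Ev par //.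
Qed.

Lemma universal_program (U : recfun) (len : nat -> nat -> nat)
    (ready : nat -> nat -> nat -> nat -> bool)
    (out : nat -> nat -> nat -> nat -> nat) :
  universal_prefix_machine U ->
  tot 2 (fun r => len (r 0) (r 1)) ->
  tot 4 (fun r => ready (r 0) (r 1) (r 2) (r 3)) ->
  tot 4 (fun r => out (r 0) (r 1) (r 2) (r 3)) ->
  (forall s t i d v, s <= t -> ready s i d v -> out t i d v = out s i d v) ->
  exists C, forall t i d v y,
    d < 2 ^ i -> v < 2 ^ len i d -> ready t i d v ->
    string_code y = out t i d v ->
    exists2 p, runs U p y & size p <= C + 2 * i + len i d.
Proof.
move=> [_ univ] tot_len hready hout stable.
have [e pe he] := prefix_machine_exists tot_len hready hout stable.
have [s hs] := univ e pe.
exists (size s).+1 => t i d v y di vl rd E.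
exists (s ++ prog i d (len i d) v); last by rewrite size_cat size_prog; lia.
by apply/hs; rewrite /runs E; exact: he.
Qed.

Lemma quadratic_le_exp2 j : 10 <= j -> 10 * j ^ 2 <= 2 ^ j.
Proof.
elim: j => [//|j IH]; rewrite leq_eqVlt => /predU1P [<- //|].
by rewrite ltnS => j10; have := IH j10; rewrite !expnS !expn0; nia.
Qed.

Lemma linear_le_exp2 i : 10 <= i -> 100 * i <= 2 ^ i.
Proof.
elim: i => [//|i IH]; rewrite leq_eqVlt => /predU1P [<- //|].
by rewrite ltnS => i10; have := IH i10; rewrite !expnS; lia.
Qed.

Lemma eps_up_large i : 10 <= i -> 6 * i + 10 <= eps_up i.
Proof.
move=> i10; have := linear_le_exp2 i10; rewrite /eps_up /str_len.
have j0 : 0 < 2 ^ i by rewrite expn_gt0.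
move: (2 ^ i) j0 => j j0 ij; have := @quadratic_le_exp2 j; rewrite expnS expn1.
move=> /(_ ltac:(lia)) h.
apply: leqW; rewrite leq_divRL; last by rewrite muln_gt0.
by apply: leq_trans h; nia.
Qed.

Lemma eps_up_small i : 10 <= i -> 900 * (i * eps_up i) <= str_len i.
Proof.
move=> i10; have := linear_le_exp2 i10; rewrite /eps_up /str_len.
have j0 : 0 < 2 ^ i by rewrite expn_gt0.
move: (2 ^ i) j0 => j j0 ij; have := @quadratic_le_exp2 j; rewrite expnS expn1.
move=> /(_ ltac:(lia)) h; have := leq_trunc_div (2 ^ j) (10 * j).
move: (2 ^ j) h => n h; move: (n %/ _) => q hq; nia.
Qed.

Lemma cover_log_size_small i : 10 <= i ->
  (cover_level i (levels i)).+1 + log_size i + 2 <= str_len i.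
Proof.
move=> i10; have := eps_up_small i10; have := eps_up_large i10.
rewrite /cover_level /threshold /levels /gap /log_size /window /log_len.
move: (eps_up i) (str_len i) => E n.
by have := leq_trunc_div n 4; nia.
Qed.

Lemma threshold_small i : 10 <= i ->
  threshold i (levels i) + eps_up i + 1 <= log_len i.
Proof.
move=> i10; have := eps_up_small i10; have := eps_up_large i10.
rewrite /threshold /levels /gap /window /log_len.
move: (eps_up i) (str_len i) => E n.
by have := ltn_ceil n (isT : 0 < 4); nia.
Qed.

(** * The history as a sequence *)

Definition encode (i : nat) (s : seq nat) : nat :=
  foldr (fun x h => x + 2 ^ (str_len i).+1 * h) 0 s.

Definition valid (i : nat) (s : seq nat) : Prop :=
  [/\ size s <= 2 ^ log_len i, uniq s
    & forall x, x \in s -> 2 ^ str_len i - 1 <= x < 2 ^ (str_len i).+1 - 1].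

Lemma str_len_gt0 i : 0 < str_len i.
Proof. by rewrite expn_gt0. Qed.

Lemma valid_gt0 i s x : valid i s -> x \in s -> 0 < x.
Proof.
move=> [_ _ h] /h /andP[+ _]; have := str_len_gt0 i.
by case: (str_len i) => // n _; have := expn_gt0 2 n; rewrite expnS; lia.
Qed.

Lemma digit_encode i s u : (forall x, x \in s -> x < 2 ^ (str_len i).+1) ->
  digit i (encode i s) u = nth 0 s u.
Proof.
rewrite /digit /encode; move: (2 ^ _) (expn_gt0 2 (str_len i).+1) => B /= B0.
elim: s u => [|x s IH] u hs; first by rewrite div0n mod0n nth_nil.
have xB : x < B by apply: hs; rewrite mem_head.
case: u => [|u] /=; first by rewrite divn1 addnC mulnC modnMDl modn_small.
rewrite expnS divnMA addnC mulnC divnMDl // (divn_small xB) addn0 IH //.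
by move=> y ys; apply: hs; rewrite inE ys orbT.
Qed.

Lemma digit_valid i s u : valid i s -> digit i (encode i s) u = nth 0 s u.
Proof. by move=> [_ _ h]; apply: digit_encode => x /h; lia. Qed.

Lemma history_size_valid i s : valid i s ->
  history_size i (encode i s) = size s.
Proof.
move=> vs; have [ss _ _] := vs.
have nz m : m < size s -> digit i (encode i s) m != 0.
  by move=> ms; rewrite digit_valid // -lt0n (valid_gt0 vs) // mem_nth.
rewrite /history_size; move: ss; rewrite leq_eqVlt => /predU1P [Es|ss].
  rewrite -[RHS](size_iota 0) Es; apply: hasNfind; apply/has_iotaP => -[m mm].
  by apply/negP/nz; rewrite Es.
apply: find_iota_eq => //; first by rewrite digit_valid // nth_default.
Qed.

Lemma used_valid i s x : valid i s -> 0 < x ->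
  used i (encode i s) x = (x \in s).
Proof.
move=> vs x0; have [ss _ _] := vs; apply/has_iotaP/idP => [[u _]|xs].
  rewrite digit_valid //; case: (ltnP u (size s)) => us.
    by move=> /eqP <-; rewrite mem_nth.
  by rewrite nth_default // => /eqP E; rewrite -E in x0.
exists (index x s); first by rewrite (leq_trans _ ss) // index_mem.
by rewrite digit_valid // nth_index.
Qed.

Lemma encode_rcons i s x :
  encode i (rcons s x) = encode i s + x * (2 ^ (str_len i).+1) ^ size s.
Proof.
elim: s => [|y s IH]; first by rewrite /encode /= muln0 addn0 muln1 add0n.
rewrite /encode /= -/(encode _ _) IH -/(encode _ _) [_ ^ (size s).+1]expnS.
by rewrite mulnDr addnA [x * (_ * _)]mulnCA.
Qed.

Lemma listed_mono U p s t i x : s <= t -> listed U p s i x -> listed U p t i x.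
Proof.
by rewrite /listed /ev1 => st /andP[h1 h2]; rewrite (ev_stable st h1) h1.
Qed.

Lemma covered_mono U b c s t i x :
  b <= c -> s <= t -> covered U b s i x -> covered U c t i x.
Proof.
move=> bc st /has_iotaP [p pb h]; apply/has_iotaP; exists p.
  by rewrite (leq_trans pb) // leq_exp2l.
exact: listed_mono h.
Qed.

Lemma cover_level_mono i d e : d <= e -> cover_level i d <= cover_level i e.
Proof.
by move=> de; rewrite /cover_level /threshold !leq_add2r leq_mul2r de orbT.
Qed.

Lemma commits_mono A s t i d x : s <= t ->
  commits A s i d x -> commits A t i d x.
Proof.
move=> st /has_iotaP [k kw /all_iotaP h]; apply/has_iotaP; exists k => //.
apply/all_iotaP => e /h /eqP E.
by rewrite /ev3 (ev_stable st) -/(ev3 _ _ _ _ _) E.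
Qed.

Lemma settled_mono U A s t i d x : s <= t ->
  settled U A s i d x -> settled U A t i d x.
Proof.
move=> st /orP[/has_iotaP [p pm /eqP E]|/orP[h|h]]; apply/orP.
- left; apply/has_iotaP; exists p => //.
  by rewrite /ev1 (ev_stable st) -/(ev1 _ _ _) E.
- by right; rewrite (covered_mono _ st h).
- by right; rewrite (commits_mono st h) orbT.
Qed.

Lemma unblockedP U A t i s : valid i s ->
  reflect (forall v d, v < size s -> d < levels i ->
      v %/ 2 ^ log_block i d < size s %/ 2 ^ log_block i d ->
      settled U A t i d (nth 0 s v))
    (unblocked U A t i (encode i s)).
Proof.
move=> vs; rewrite /unblocked history_size_valid //.
apply: (iffP (all_iotaP _ _)).
  move=> h v d /h /all_iotaP h' /h' /implyP; rewrite digit_valid //.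
move=> h v vs'; apply/all_iotaP => d dl; apply/implyP; rewrite digit_valid //.
exact: h.
Qed.

Lemma freshP U t i s (x := fresh U t i (encode i s)) : 10 <= i -> valid i s ->
  [/\ 2 ^ str_len i - 1 <= x < 2 ^ (str_len i).+1 - 1, x \notin s
    & ~~ covered U (cover_level i (levels i)) t i x].
Proof.
move=> i10 vs; rewrite {}/x /fresh; set P := fun q => _ && _.
have q0 q : 0 < 2 ^ str_len i - 1 + q.
  by have := str_len_gt0 i; case: (str_len i) => // n _; have := expn_gt0 2 n;
    rewrite expnS; lia.
have [lt|] := ltnP (find P (iota 0 (2 ^ str_len i))) (2 ^ str_len i).
  have [/andP[h1 h2] _] := find_iotaP lt; rewrite used_valid // in h1.
  by split=> //; rewrite expnS; lia.
move=> nofresh; exfalso.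
have hP q : q < 2 ^ str_len i -> ~~ P q.
  move=> qn; apply/negP => Pq.
  have := @before_find _ 0 P (iota 0 (2 ^ str_len i)) q.
  by rewrite nth_iota // Pq => /(_ (leq_trans qn nofresh)).
pose X := [seq 2 ^ str_len i - 1 + q | q <- iota 0 (2 ^ str_len i)].
pose Y := [seq sd_head (sd_drop j (ev1 U t p).-1) |
  p <- iota 0 (2 ^ (cover_level i (levels i)).+1),
  j <- iota 0 (2 ^ log_size i)].
have uX : uniq X by rewrite map_inj_uniq ?iota_uniq // => a b /addnI.
have sX : {subset X <= s ++ Y}.
  move=> y /mapP [q]; rewrite mem_iota => /andP[_ /hP]; rewrite negb_and !negbK.
  rewrite used_valid // mem_cat => /orP[h -> |/has_iotaP [p hp /andP[_]]].
    by rewrite h.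
  move=> /has_iotaP [j hj /eqP E] ->; rewrite -E.
  by apply/orP; right; apply: allpairs_f; rewrite mem_iota.
have := uniq_leq_size uX sX.
rewrite size_map size_cat size_allpairs !size_iota -expnD.
have [ss _ _] := vs; have := cover_log_size_small i10.
case: (str_len i) => [|[|n]].
- by rewrite addn2.
- by rewrite addn2.
rewrite addn2 !ltnS => h; have := leq_pexp2l (isT : 0 < 2) h.
have : 2 ^ log_len i <= 2 ^ n.
  rewrite leq_exp2l //; move: h; rewrite /log_size; lia.
move: (expn_gt0 2 n); rewrite (expnS 2 n.+1) (expnS 2 n) => /= n0 h1 h2 h3.
by have := leq_trans h3 (leq_add (leq_trans ss h1) h2); lia.
Qed.

(** * The process gets stuck *)

Fixpoint trace (U A : recfun) (i t : nat) : seq nat :=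
  if t is t'.+1 then
    let s := trace U A i t' in
    if (size s < 2 ^ log_len i) && unblocked U A t' i (encode i s)
    then rcons s (fresh U t' i (encode i s)) else s
  else [::].

Lemma trace_valid U A i t : 10 <= i -> valid i (trace U A i t).
Proof.
move=> i10; elim: t => [|t IH] /=; first by split.
case: ifP => // /andP[lt _]; have [h1 h2 _] := freshP U t i10 IH.
have [_ us hs] := IH; split; first by rewrite size_rcons.
  by rewrite rcons_uniq h2.
by move=> x; rewrite mem_rcons inE => /predU1P [->|/hs].
Qed.

Lemma historyE U A i t : 10 <= i -> history U A t i = encode i (trace U A i t).
Proof.
move=> i10; elim: t => [//|t IH].
rewrite /history /= -/(history _ _ _ _) IH /extend.
rewrite history_size_valid; last exact: trace_valid.
by case: ifP => // _; rewrite encode_rcons.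
Qed.

Lemma trace_cat U A i s t : s <= t ->
  exists r, trace U A i t = trace U A i s ++ r.
Proof.
elim: t => [|t IH]; first by rewrite leqn0 => /eqP ->; exists [::].
rewrite leq_eqVlt => /predU1P [->|]; first by exists [::]; rewrite cats0.
rewrite ltnS => /IH [r E]; rewrite /= {}E; case: ifP => _; last by exists r.
by rewrite rcons_cat; eexists.
Qed.

Lemma trace_size U A i s t : s <= t ->
  size (trace U A i s) <= size (trace U A i t).
Proof. by move=> /(trace_cat U A i) [r ->]; rewrite size_cat leq_addr. Qed.

Lemma trace_nth U A i s t u : s <= t -> u < size (trace U A i s) ->
  nth 0 (trace U A i t) u = nth 0 (trace U A i s) u.
Proof. by move=> /(trace_cat U A i) [r ->] us; rewrite nth_cat us. Qed.

Lemma trace_appended U A i s t u :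
  size (trace U A i s) <= u < size (trace U A i t) ->
  exists2 r, s <= r & [/\ size (trace U A i r) = u, r < t,
    unblocked U A r i (encode i (trace U A i r)) &
    nth 0 (trace U A i t) u = fresh U r i (encode i (trace U A i r))].
Proof.
move=> /andP[su]; elim: t => [//|t IH] ut.
have [ut'|tu] := ltnP u (size (trace U A i t)).
  have [r sr [h1 h2 h3 h4]] := IH ut'; exists r => //; split=> //.
    exact: leqW.
  by rewrite (trace_nth (leqnSn t)).
have st : s <= t.
  rewrite leqNgt; apply/negP => ts.
  by have := leq_trans ut (leq_trans (trace_size U A i ts) su); rewrite ltnn.
move: ut => /=; case: ifP => [/andP[_ h]|_]; last by rewrite ltnNge tu.
rewrite size_rcons ltnS => ut; have Eu : size (trace U A i t) = u.
  by apply/eqP; rewrite eqn_leq tu ut.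
by exists t => //; split=> //; rewrite nth_rcons Eu ltnn eqxx.
Qed.

Lemma ltn_div_block u m b : b <= m -> u < 2 ^ m ->
  (u %/ 2 ^ b).+1 * 2 ^ b <= 2 ^ m.
Proof.
move=> bm um; rewrite -[X in _ <= 2 ^ X](subnK bm) expnD leq_mul2r.
apply/orP; right.
by rewrite ltn_divLR ?expn_gt0 // -expnD subnK.
Qed.

Lemma leq_log_block i d : log_block i d <= log_len i.
Proof. exact: leq_subr. Qed.

Lemma settled_in_time U A i T u d (x := trace U A i T) :
  10 <= i -> size x = 2 ^ log_len i -> unblocked U A T i (encode i x) ->
  u < 2 ^ log_len i -> d < levels i ->
  exists2 t, settled U A t i d (nth 0 x u) &
    forall v, v < 2 ^ log_len i ->
      u %/ 2 ^ log_block i d < v %/ 2 ^ log_block i d ->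
      ~~ covered U (cover_level i (levels i)) t i (nth 0 x v).
Proof.
move=> i10 sx goT um dl; have vx t : valid i (trace U A i t).
  exact: trace_valid.
have := ltn_div_block (leq_log_block i d) um.
set e := _ * _; have b0 : 0 < 2 ^ log_block i d by rewrite expn_gt0.
have ue : u < e by rewrite -ltn_divLR.
have ve v : u %/ 2 ^ log_block i d < v %/ 2 ^ log_block i d -> e <= v.
  by rewrite leq_divRL.
rewrite leq_eqVlt => /predU1P [Ee|em].
  exists T => [|v vm /ve]; last by rewrite Ee leqNgt vm.
  apply: (unblockedP _ _ _ (vx T)) => //; rewrite sx //.
  by rewrite -Ee mulnK.
have [|r _ [sr rT gor _]] := @trace_appended U A i 0 T e.
  by rewrite /= -/x sx em.
have xr : nth 0 x u = nth 0 (trace U A i r) u.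
  by apply: trace_nth; [exact: ltnW | rewrite sr].
exists r.
  rewrite xr; apply: (unblockedP _ _ _ (vx r)) => //; rewrite sr //.
  by rewrite mulnK.
move=> v vm /ve ev.
have [|q rq [_ _ _ ->]] := @trace_appended U A i r T v.
  by rewrite sr ev -/x sx.
have [_ _ + ] := freshP U q i10 (vx q).
by apply: contra; exact: covered_mono.
Qed.

Lemma listed_at U p s t i x : listed U p s i x -> 0 < ev1 U t p ->
  listed U p t i x.
Proof.
rewrite /listed /ev1 => /andP[hs h] ht; rewrite ht /=.
have [st|/ltnW ts] := leqP s t; first by rewrite (ev_stable st hs).
by rewrite -(ev_stable ts ht).
Qed.

Lemma not_commits_all A i x :
  ~ (forall d, d < levels i -> exists t, commits A t i d x).
Proof.
move=> h; pose P d k := d < levels i -> k < window i + 2 /\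
  exists t, forall e, e <= levels i ->
    ev3 A t x ((log_len i).-1 + k) (threshold i e) = 1 + (d < e).
have [f hf] : exists f, forall d, P d (f d).
  suff /choice [f hf] : forall d, exists k, P d k by exists f.
  move=> d; have [dl|ld] := ltnP d (levels i); last first.
    by exists 0; rewrite /P ltnNge ld.
  have [t /has_iotaP [k kw /all_iotaP hk]] := h d dl; exists k => _; split=> //.
  by exists t => e el; apply/eqP/hk.
have f_neq d e : d < e -> e < levels i -> f d <> f e.
  move=> de el E; have [_ [s hs]] := hf d (ltn_trans de el).
  have [_ [t ht]] := hf e el.
  have := hs e (ltnW el); have := ht e (ltnW el); rewrite E de ltnn.
  set k := _ + _; have [st|/ltnW ts] := leqP s t.
    by rewrite /ev3 => + Es; rewrite (ev_stable st) Es.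
  by rewrite /ev3 => Et; rewrite (ev_stable ts) Et.
have uf : uniq [seq f d | d <- iota 0 (levels i)].
  rewrite map_inj_in_uniq ?iota_uniq // => d e; rewrite !mem_iota /= => dl el E.
  by case: (ltngtP d e) => // de; [case: (f_neq d e) | case: (f_neq e d)].
have sf : {subset [seq f d | d <- iota 0 (levels i)] <= iota 0 (window i + 2)}.
  move=> k /mapP [d]; rewrite mem_iota => /= /hf [kw _] ->.
  by rewrite mem_iota.
have := uniq_leq_size uf sf; rewrite size_map !size_iota /levels /window; lia.
Qed.

Lemma cover_level_log_block i d : 10 <= i -> d < levels i ->
  (cover_level i d).+1 + log_block i d = log_len i - eps_up i + window i + 1.
Proof.
move=> i10 dl; have := threshold_small i10.
rewrite /cover_level /log_block /threshold /gap.
have : d.+1 * eps_up i <= levels i * eps_up i by rewrite leq_mul2r dl orbT.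
nia.
Qed.

Lemma never_complete U A i T (x := trace U A i T) :
  10 <= i -> size x = 2 ^ log_len i -> ~~ unblocked U A T i (encode i x).
Proof.
move=> i10 sx; apply/negP => goT; have vx : valid i x by exact: trace_valid.
pose killed d p u := exists2 t, listed U p t i (nth 0 x u) &
  forall v, v < 2 ^ log_len i ->
    u %/ 2 ^ log_block i d < v %/ 2 ^ log_block i d ->
    ~~ covered U (cover_level i (levels i)) t i (nth 0 x v).
have killed_block d p u v : d < levels i -> p < 2 ^ (cover_level i d).+1 ->
    u < 2 ^ log_len i -> v < 2 ^ log_len i -> killed d p u -> killed d p v ->
    ~ u %/ 2 ^ log_block i d < v %/ 2 ^ log_block i d.
  move=> dl pd um vm [s hs nocov] [t ht _] uv.
  move/negP: (nocov v vm uv); apply; apply/has_iotaP; exists p.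
    by rewrite (leq_trans pd) // leq_exp2l // ltnS cover_level_mono // ltnW.
  by apply: listed_at ht _; case/andP: hs.
pose block d p := xget 0 [set w | exists2 u, u < 2 ^ log_len i /\ killed d p u &
  u %/ 2 ^ log_block i d = w].
have blockE d p u : d < levels i -> p < 2 ^ (cover_level i d).+1 ->
    u < 2 ^ log_len i ->
    killed d p u -> block d p = u %/ 2 ^ log_block i d.
  move=> dl pd um ku; rewrite /block; case: xgetP => [w _ [v [vm kv] <-]|].
    have [vu|uv|//] := ltngtP (v %/ 2 ^ log_block i d) (u %/ 2 ^ log_block i d).
      by case: (killed_block d p v u).
    by case: (killed_block d p u v).
  by move=> /(_ (u %/ 2 ^ log_block i d)); case; exists u.
pose value p := xget 0 [set y | exists t, ev1 U t p = y.+1].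
have valueE p t y : ev1 U t p = y.+1 -> value p = y.
  move=> E; rewrite /value; case: xgetP => [z _ [s Es]|/(_ y)]; last first.
    by case; exists t.
  apply: succn_inj; rewrite -E -Es /ev1; case/orP: (leq_total s t) => st.
    by rewrite (ev_stable st) // -/(ev1 _ _ _) Es.
  by rewrite (ev_stable st) // -/(ev1 _ _ _) E.
pose Lsimple := [seq index (value p) x | p <- iota 0 (2 ^ (log_len i).-1)].
pose Lkilled d := [seq block d p * 2 ^ log_block i d + r |
  p <- iota 0 (2 ^ (cover_level i d).+1), r <- iota 0 (2 ^ log_block i d)].
pose L := Lsimple ++ flatten [seq Lkilled d | d <- iota 0 (levels i)].
have sL : size L < 2 ^ log_len i.
  rewrite size_cat size_map size_iota size_flatten /shape -map_comp.
  have -> : [seq (size \o Lkilled) d | d <- iota 0 (levels i)] =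
      nseq (levels i) (2 ^ (log_len i - eps_up i + window i + 1)).
    set K := 2 ^ _; set s := map _ _; have -> : levels i = size s.
      by rewrite size_map size_iota.
    apply/all_pred1P/allP => y /mapP [d]; rewrite mem_iota => /= dl E.
    rewrite E /= /Lkilled size_allpairs !size_iota -expnD.
    by rewrite cover_level_log_block.
  have := eps_up_large i10; have := threshold_small i10; rewrite sumn_nseq.
  rewrite /threshold {1}/levels {1 2}/window => h1 h2.
  have h3 : levels i < 2 ^ levels i by rewrite ltn_expl.
  set e := log_len i - eps_up i + window i + 1.
  have h4 : 2 ^ e * levels i < 2 ^ (log_len i).-1.
    apply: (@leq_trans (2 ^ e * 2 ^ levels i)).
      by rewrite ltn_pmul2l ?expn_gt0.
    by rewrite -expnD leq_exp2l // /e /levels /window; lia.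
  rewrite -[X in _ < 2 ^ X]prednK; last lia.
  by rewrite expnS mul2n -addnn ltn_add2l.
have [u um uL] : exists2 u, u < 2 ^ log_len i & u \notin L.
  case: (allPn (a := fun u => u \in L) (s := iota 0 (2 ^ log_len i)) _).
    apply/negP => /allP sub; have := uniq_leq_size (iota_uniq _ _) sub.
    by rewrite size_iota leqNgt sL.
  by move=> u; rewrite mem_iota => um uL; exists u.
case: (@not_commits_all A i (nth 0 x u)) => d dl.
have [t] := settled_in_time i10 sx goT um dl; rewrite -/x => + nocov.
rewrite /settled => /orP[/has_iotaP [p pm /eqP E]|/orP[|]]; last by exists t.
  case/negP: uL; rewrite mem_cat; apply/orP; left.
  apply/mapP; exists p; first by rewrite mem_iota.
  rewrite (valueE _ _ _ E) index_uniq ?sx //.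
  by case: vx.
move=> /has_iotaP [p pd lp]; case/negP: uL; rewrite mem_cat; apply/orP; right.
apply/flatten_mapP; exists d; first by rewrite mem_iota.
have ku : killed d p u by exists t.
rewrite /Lkilled [u in u \in _](divn_eq u (2 ^ log_block i d)).
rewrite -(blockE d p u dl pd um ku); apply/allpairsP.
exists (p, u %% 2 ^ log_block i d); rewrite !mem_iota /= pd; split=> //.
by rewrite ltn_mod expn_gt0.
Qed.

Lemma stuck U A i : 10 <= i -> exists T u d,
  [/\ d < levels i, u < 2 ^ log_len i,
      (u %/ 2 ^ log_block i d).+1 * 2 ^ log_block i d <= size (trace U A i T)
    & forall t, ~~ settled U A t i d (nth 0 (trace U A i T) u)].
Proof.
move=> i10.
have vx t : valid i (trace U A i t) by exact: trace_valid.
pose P k := `[< exists t, size (trace U A i t) = k >].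
have exP : exists k, P k by exists 0; apply/asboolP; exists 0.
have ubP k : P k -> k <= 2 ^ log_len i.
  by move=> /asboolP [t <-]; case: (vx t).
case: (ex_maxnP exP ubP) => k /asboolP [T sT] maxk.
have sizeE t : T <= t -> size (trace U A i t) = k.
  move=> Tt; apply/eqP; rewrite eqn_leq; apply/andP; split.
    by apply: maxk; apply/asboolP; exists t.
  by rewrite -sT; exact: trace_size.
apply: contrapT => nostuck.
have [t ht] : exists t, forall d, d < levels i -> forall v, v < k ->
    v %/ 2 ^ log_block i d < k %/ 2 ^ log_block i d ->
    settled U A t i d (nth 0 (trace U A i T) v).
  apply: (@eventually_forall_lt (levels i) (fun d t => forall v, v < k ->
    v %/ 2 ^ log_block i d < k %/ 2 ^ log_block i d ->
    settled U A t i d (nth 0 (trace U A i T) v))).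
    by move=> d s t st h v vk hv; apply: settled_mono st _; exact: h.
  move=> d dl; apply: (@eventually_forall_lt k (fun v t =>
    v %/ 2 ^ log_block i d < k %/ 2 ^ log_block i d ->
    settled U A t i d (nth 0 (trace U A i T) v))).
    by move=> v s t st h hv; apply: settled_mono st _; exact: h.
  move=> v vk; set B := 2 ^ _.
  have [hv|hv] := ltnP (v %/ B) (k %/ B); last first.
    by exists 0 => //.
  apply: contrapT => never; apply: nostuck; exists T, v, d; split=> //.
  - by rewrite (leq_trans vk) // -sT; case: (vx T).
  - by rewrite sT -leq_divRL ?expn_gt0.
  - by move=> t; apply/negP => h; apply: never; exists t.
pose t' := maxn t T.
have Tt' : T <= t' by exact: leq_maxr.
have got' : unblocked U A t' i (encode i (trace U A i t')).
  apply/unblockedP => // v d; rewrite sizeE // => vk dl hv.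
  rewrite (trace_nth Tt') ?sT //; apply: settled_mono (leq_maxl t T) _.
  exact: ht.
have [kN|Nk] := ltnP k (2 ^ log_len i).
  have := sizeE t'.+1 (leqW Tt').
  rewrite /= sizeE // kN got' size_rcons sizeE //; lia.
have sN : size (trace U A i t') = 2 ^ log_len i.
  rewrite sizeE //; apply/eqP; rewrite eqn_leq Nk ubP //.
  by apply/asboolP; exists T.
by move/negP: (never_complete i10 sN).
Qed.

(** * Complexity of the enumerated strings and blocks *)

Lemma K_le U x p : runs U p x -> K U x <= size p.
Proof. by move=> h; apply: (min_sizeP (ex_intro _ p h)).2. Qed.

Lemma K_program U x : universal_prefix_machine U ->
  exists2 p, runs U p x & size p = K U x.
Proof. by move=> univ; case: (min_sizeP (universal_outputs x univ)). Qed.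

Lemma Kset_le U (S : {fset bitstring}) p l :
  perm_eq l (enum_fset S) -> runs U p (listing l) -> Kset U S <= size p.
Proof.
move=> lS h.
have hp : exists2 l, perm_eq l (enum_fset S) & runs U p (listing l).
  by exists l.
exact: (min_sizeP (ex_intro _ p hp)).2.
Qed.

Lemma Kset_program U (S : {fset bitstring}) : universal_prefix_machine U ->
  exists p l, [/\ perm_eq l (enum_fset S), runs U p (listing l)
    & size p = Kset U S].
Proof.
move=> univ; have [p hp] := universal_outputs (listing (enum_fset S)) univ.
have [|[q [l lS hq] sq] _] := @min_sizeP [set p | exists2 l,
    perm_eq l (enum_fset S) & runs U p (listing l)].
  by exists p, (enum_fset S).
by exists q, l.
Qed.

Lemma runs_ev1 U p y : runs U p y ->
  exists t, ev1 U t (string_code p) = (string_code y).+1.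
Proof. exact: ev_complete. Qed.

Lemma string_code_lt p c : size p <= c -> string_code p < 2 ^ c.+1.
Proof.
move=> pc; have /andP[_ h] := string_code_bounds p.
by apply: ltn_trans (leq_trans h _); rewrite ?leq_exp2l ?ltnS.
Qed.

Lemma size_of_code n x :
  2 ^ n - 1 <= string_code x < 2 ^ n.+1 - 1 -> size x = n.
Proof.
have /andP[lo hi] := string_code_bounds x => /andP[lo' hi'].
have n0 := expn_gt0 2 n; apply/eqP; rewrite eqn_leq.
by apply/andP; split; rewrite -ltnS -(@ltn_exp2l 2) //; lia.
Qed.

Definition block_length (i d : nat) : nat := d.+1 * gap i.

Definition block_ready (U A : recfun) (t i d v : nat) : bool :=
  (10 <= i) && (0 < digit i (history U A t i) (v.+1 * 2 ^ log_block i d).-1).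

Definition block_listing (U A : recfun) (t i d v : nat) : nat :=
  iteri (2 ^ log_block i d)
    (fun m z =>
      sd_cons (digit i (history U A t i) (v * 2 ^ log_block i d + m)) z) 0.

Definition element_ready (U A : recfun) (t i d v : nat) : bool :=
  (10 <= i) && (0 < digit i (history U A t i) v).

Definition element (U A : recfun) (t i d v : nat) : nat :=
  digit i (history U A t i) v.

Lemma tot_block_length : tot 2 (fun r => block_length (r 0) (r 1)).
Proof. by rewrite /block_length; tot. Qed.

Lemma tot_block_ready U A :
  tot 4 (fun r => block_ready U A (r 0) (r 1) (r 2) (r 3)).
Proof. by rewrite /block_ready; tot. Qed.

Lemma tot_block_listing U A :
  tot 4 (fun r => block_listing U A (r 0) (r 1) (r 2) (r 3)).
Proof. by rewrite /block_listing; tot. Qed.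

Lemma tot_element_ready U A :
  tot 4 (fun r => element_ready U A (r 0) (r 1) (r 2) (r 3)).
Proof. by rewrite /element_ready; tot. Qed.

Lemma tot_element U A : tot 4 (fun r => element U A (r 0) (r 1) (r 2) (r 3)).
Proof. by rewrite /element; tot. Qed.

Lemma digit_history U A t i u : 10 <= i ->
  digit i (history U A t i) u = nth 0 (trace U A i t) u.
Proof.
by move=> i10; rewrite historyE // digit_valid //; exact: trace_valid.
Qed.

Lemma digit_history_gt0 U A t i u : 10 <= i ->
  (0 < digit i (history U A t i) u) = (u < size (trace U A i t)).
Proof.
move=> i10; rewrite digit_history //.
have [h|h] := ltnP u (size (trace U A i t)).
  by rewrite (valid_gt0 (trace_valid U A t i10)) // mem_nth.
by rewrite nth_default.
Qed.

Lemma element_stable U A s t i d v : s <= t -> element_ready U A s i d v ->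
  element U A t i d v = element U A s i d v.
Proof.
move=> st /andP[i10]; rewrite digit_history_gt0 // => vs.
by rewrite /element !digit_history // (trace_nth st).
Qed.

Lemma block_listing_stable U A s t i d v : s <= t ->
  block_ready U A s i d v ->
  block_listing U A t i d v = block_listing U A s i d v.
Proof.
move=> st /andP[i10]; rewrite digit_history_gt0 // => vs.
rewrite /block_listing; pose F t m z :=
  sd_cons (digit i (history U A t i) (v * 2 ^ log_block i d + m)) z.
suff H k : k <= 2 ^ log_block i d -> iteri k (F t) 0 = iteri k (F s) 0.
  exact: H.
elim: k => [//|k IH] kB /=; rewrite IH; last exact: ltnW.
rewrite /F !digit_history // (trace_nth st) //; apply: leq_ltn_trans vs.
by rewrite mulSn; lia.
Qed.

Lemma listing_iteri (f : nat -> bitstring) k :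
  iteri k (fun m z => sd_cons (string_code (f m)) z) 0
  = string_code (listing (rev (mkseq f k))).
Proof.
elim: k => [//|k IH].
by rewrite -[in RHS]addn1 /mkseq iotaD map_cat rev_cat /= IH sd_consE.
Qed.

Lemma universal_programs (U A : recfun) : universal_prefix_machine U ->
  exists C, forall t i, 10 <= i ->
    (forall u x, u < 2 ^ log_len i -> u < size (trace U A i t) ->
      string_code x = nth 0 (trace U A i t) u ->
      exists2 p, runs U p x & size p <= C + 2 * i + log_len i) /\
    (forall d v f, d < 2 ^ i -> v < 2 ^ (d.+1 * gap i) ->
      v.+1 * 2 ^ log_block i d <= size (trace U A i t) ->
      (forall j, string_code (f j) =
        nth 0 (trace U A i t) (v * 2 ^ log_block i d + j)) ->
      exists2 p, runs U p (listing (rev (mkseq f (2 ^ log_block i d))))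
        & size p <= C + 2 * i + d.+1 * gap i).
Proof.
move=> univ.
have tot_len : tot 2 (fun r => log_len (r 0)) by tot.
have [C1 h1] := @universal_program U (fun i _ => log_len i) _ _ univ tot_len
  (tot_element_ready U A) (tot_element U A) (@element_stable U A).
have [C2 h2] := @universal_program U _ _ _ univ tot_block_length
  (tot_block_ready U A) (tot_block_listing U A) (@block_listing_stable U A).
exists (C1 + C2) => t i i10; split=> [u x um ut E|d v f di vd vt E].
  have [||||p hp sp] := h1 t i 0 u x; rewrite ?expn_gt0 //.
  - by rewrite /element_ready i10 digit_history_gt0.
  - by rewrite /element digit_history.
  by exists p => //; apply: leq_trans sp _; lia.
have [||||p hp sp] :=
  h2 t i d v (listing (rev (mkseq f (2 ^ log_block i d)))) => //.
- rewrite /block_ready i10 digit_history_gt0 //= prednK //.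
  by rewrite muln_gt0 expn_gt0.
- rewrite -listing_iteri /block_listing; congr iteri.
  by apply/funext => m; apply/funext => z; rewrite E digit_history.
by exists p => //; apply: leq_trans sp _; rewrite /block_length; lia.
Qed.

Lemma hard_string (U A : recfun) : universal_prefix_machine U ->
  exists i, 10 <= i /\ exists x d,
  [/\ size x = str_len i /\ d < levels i,
      (log_len i).-1 <= K U x <= log_len i + window i,
      forall S : {fset bitstring}, x \in S -> Kset U S <= cover_level i d ->
        2 ^ log_size i < #|` S|%fset,
      exists S : {fset bitstring}, [/\ x \in S,
        Kset U S <= d.+1 * gap i + window i & #|` S|%fset = 2 ^ log_block i d]
    & forall t, ~~ commits A t i d (string_code x)].
Proof.
move=> univ; have [C hC] := universal_programs A univ.
have [i [i10 Ci]] : exists i, 10 <= i /\ C <= i.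
  by exists (10 + C); rewrite leq_addr leq_addl.
exists i; split=> //.
have [T [u [d [dl um ut nodone]]]] := stuck U A i10.
have [px pS] := hC T i i10.
have [g gK Kg] := string_code_bij.
pose y j := g (nth 0 (trace U A i T) j).
have yE j : string_code (y j) = nth 0 (trace U A i T) j by exact: Kg.
have vT := trace_valid U A T i10.
have b0 : 0 < 2 ^ log_block i d by rewrite expn_gt0.
have uT : u < size (trace U A i T).
  by apply: leq_trans ut; rewrite -ltn_divLR.
exists (y u), d.
have sx : size (y u) = str_len i.
  by apply: size_of_code; rewrite yE; case: vT => _ _; apply; rewrite mem_nth.
have nobad t : ~~ commits A t i d (string_code (y u)).
  apply: contra (nodone t); rewrite yE /settled => ->; rewrite !orbT //.
have la := threshold_small i10.
have dam : d.+1 * gap i + 1 <= log_len i.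
  have : d.+1 * gap i <= levels i * gap i by rewrite leq_mul2r dl orbT.
  by move: la; rewrite /threshold; lia.
have bE : log_len i = d.+1 * gap i + log_block i d.
  by rewrite /log_block subnKC //; lia.
split=> //.
- apply/andP; split; last first.
    have [p hp sp] := px u (y u) um uT (yE u).
    by apply: leq_trans (K_le hp) (leq_trans sp _); rewrite /window; lia.
  rewrite leqNgt; apply/negP => lt.
  have [p /runs_ev1 [t ht] sp] := K_program (y u) univ.
  case/negP: (nodone t); apply/orP; left; apply/has_iotaP.
  exists (string_code p); last by rewrite ht yE.
  rewrite -[X in _ < 2 ^ X]prednK; last lia.
  by apply: string_code_lt; rewrite sp; lia.
- move=> S xS KS; rewrite ltnNge; apply/negP => small.
  have [p [l [lS /runs_ev1 [t ht] sp]]] := Kset_program S univ.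
  case/negP: (nodone t); apply/orP; right; apply/orP; left; apply/has_iotaP.
  exists (string_code p); first by apply: string_code_lt; rewrite sp.
  have xl : y u \in l by rewrite (perm_mem lS).
  rewrite /listed ht /=; apply/has_iotaP; exists (index (y u) l).
    by rewrite (leq_trans _ small) // -(perm_size lS) index_mem.
  by rewrite sd_head_drop ?index_mem // nth_index // yE.
- set v := u %/ 2 ^ log_block i d in ut.
  pose f j := y (v * 2 ^ log_block i d + j).
  have vd : v < 2 ^ (d.+1 * gap i).
    by rewrite ltn_divLR // -expnD -bE.
  have d2 : d < 2 ^ i.
    have := linear_le_exp2 i10; move: dl; rewrite /levels; lia.
  have [p hp sp] := pS d v f d2 vd ut (fun j => yE _).
  set l := rev _ in hp.
  have ul : uniq l.
    rewrite rev_uniq map_inj_in_uniq ?iota_uniq // => j k.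
    rewrite !mem_iota /= => jb kb /(congr1 string_code); rewrite !yE.
    have lt m : m < 2 ^ log_block i d ->
        v * 2 ^ log_block i d + m < size (trace U A i T).
      by move=> mb; apply: leq_trans ut; rewrite mulSn; lia.
    case: vT => _ uqT _ /eqP; rewrite nth_uniq ?lt // => /eqP; exact: addnI.
  exists [fset z | z in l]%fset; split.
  + rewrite in_fset /= mem_rev; apply/mapP; exists (u %% 2 ^ log_block i d).
      by rewrite mem_iota /= ltn_mod.
    by rewrite /f /v -divn_eq.
  + have lS : perm_eq l (enum_fset [fset z | z in l]%fset).
      by apply: uniq_perm ul (fset_uniq _) _ => z; rewrite in_fset.
    apply: leq_trans (Kset_le lS hp) (leq_trans sp _).
    rewrite /window; lia.
  + by rewrite card_fseq undup_id // size_rev size_mkseq.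
Qed.

Lemma log_len_large i : 10 <= i -> 2 ^ i < log_len i.
Proof.
move=> i10; rewrite /log_len /str_len; have := linear_le_exp2 i10.
move: (2 ^ i) => j ij; have := @quadratic_le_exp2 j; rewrite expnS expn1.
move=> /(_ ltac:(lia)) h; rewrite leq_divRL //.
by apply: leq_trans h; nia.
Qed.

Local Open Scope ring_scope.

Lemma log2_exp (R : realType) (n : nat) : log2 (2 ^ n)%:R = n%:R :> R.
Proof.
rewrite /log2 natrX lnXn // -[_ *+ n]mulr_natl mulfK //.
by rewrite gt_eqF // ln_gt0 // ltr1n.
Qed.

Lemma le_log2 (R : realType) (m n : nat) : (0 < m)%N -> (m <= n)%N ->
  log2 m%:R <= log2 n%:R :> R.
Proof.
move=> m0 mn; rewrite /log2 ler_pM2r.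
  by rewrite ler_ln ?posrE ?ltr0n ?ler_nat // (leq_trans m0).
by rewrite invr_gt0 ln_gt0 // ltr1n.
Qed.

Lemma epsilon_le (R : realType) (x : bitstring) i : size x = str_len i ->
  0 <= epsilon R x <= (eps_up i)%:R.
Proof.
move=> sx; rewrite /epsilon sx /str_len log2_exp -natrM; apply/andP; split.
  by rewrite divr_ge0.
rewrite ler_pdivrMr ?ltr0n ?muln_gt0 ?expn_gt0 // -natrM ler_nat.
by rewrite /eps_up /str_len ltnW // ltn_ceil // muln_gt0 expn_gt0.
Qed.

Theorem mainTheorem13 (R : realType) (U : recfun)
    (HU : universal_prefix_machine U) :
  ~ exists A : recfun,
      forall (x : bitstring) (k alpha : nat) (eps : R),
        (1 < size x)%N ->
        k = K U x ->
        eps = epsilon R x ->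
        eps <= alpha%:R <= k%:R - eps ->
        ((lambda U x (alpha%:R - eps) < (k%:R + 6 * log2 k%:R)%:E)%E ->
           rec_eval A [:: string_code x; k; alpha] 1)
        /\
        ((lambda U x (alpha%:R + eps) > (k%:R + 3 * eps)%:E)%E ->
           rec_eval A [:: string_code x; k; alpha] 0).
Proof.
move=> [A hA].
have [i [i10 [x [d [[sx dl] /andP[mK Km] large [S [xS KS cS]] nobad]]]]] :=
  hard_string A HU.
set k := K U x in mK Km.
have /andP[eps0 epsE] := epsilon_le R sx; set eps := epsilon R x in eps0 epsE.
have x1 : (1 < size x)%N.
  by rewrite sx /str_len -{1}[1%N](expn0 2) ltn_exp2l // expn_gt0.
have la := threshold_small i10; have ml := log_len_large i10.
have answer e : (e <= levels i)%N ->
    rec_eval A [:: string_code x; k; threshold i e] (d < e)%N.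
  move=> el; have te : (threshold i e <= threshold i (levels i))%N.
    by rewrite /threshold !leq_add2r leq_mul2r el orbT.
  have [|h1 h0] := hA x k (threshold i e) eps x1 erefl erefl.
    apply/andP; split.
      by apply: le_trans epsE _; rewrite ler_nat /threshold leq_addl.
    rewrite lerBrDr; apply: le_trans (lerD (lexx _) epsE) _.
    by rewrite -natrD ler_nat; lia.
  have [de|ed] := ltnP d e.
    apply: h1; apply: (@le_lt_trans _ _ (Lambda R U S)%:E).
      apply: ereal_inf_lbound; exists S => //; split=> //.
      rewrite lerBrDr; apply: le_trans (lerD (lexx _) epsE) _.
      rewrite -natrD ler_nat /threshold leq_add2r (leq_trans KS) // leq_add2r.
      by rewrite leq_mul2r de orbT.
    rewrite lte_fin /Lambda cS log2_exp.
    have Lk :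
        (Kset U S)%:R + (log_block i d)%:R <= k%:R + 3%:R * i%:R + 3%:R :> R.
      have : (d.+1 * gap i + log_block i d <= log_len i)%N.
        rewrite /log_block subnKC //.
        have : (d.+1 * gap i <= levels i * gap i)%N.
          by rewrite leq_mul2r dl orbT.
        by move: la; rewrite /threshold; lia.
      rewrite -natrM -!natrD ler_nat; move: KS mK ml; rewrite /window; lia.
    have hk : (2 ^ i <= k)%N by lia.
    have := le_log2 R (expn_gt0 2 i : (0 < 2 ^ i)%N) hk; rewrite log2_exp.
    have : (10%:R : R) <= i%:R by rewrite ler_nat.
    lra.
  apply: h0; apply: (@lt_le_trans _ _ (log_size i)%:R%:E).
    rewrite lte_fin /log_size; move: Km epsE.
    move: (log_len i) (window i) (eps_up i) => m w E; rewrite -(ler_nat R).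
    rewrite (natrD _ (m + w + 3 * E)) (natrD _ (m + w)) (natrD _ m) natrM.
    lra.
  apply/ereal_infP => _ [S' [xS' KS'] <-]; rewrite lee_fin /Lambda.
  have lS' : (2 ^ log_size i < #|` S'|%fset)%N.
    apply: large => //; rewrite -(ler_nat R); apply: le_trans KS' _.
    apply: le_trans (lerD (lexx _) epsE) _.
    rewrite -natrD ler_nat -/(cover_level i e); exact: cover_level_mono.
  apply: (@le_trans _ _ (log2 #|` S'|%fset%:R)); last by rewrite lerDr.
  by rewrite -(log2_exp R (log_size i)) le_log2 ?expn_gt0 // ltnW.
have [t ht] : exists t, forall e, (e < (levels i).+1)%N ->
    ev3 A t (string_code x) k (threshold i e) = (1 + (d < e))%N.
  apply: eventually_forall_lt => [e s t st E|e el].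
    by rewrite /ev3 (ev_stable st) -/(ev3 _ _ _ _ _) E.
  by have [t E] := ev_complete (answer e el); exists t.
case/negP: (nobad t); apply/has_iotaP; exists (k - (log_len i).-1)%N.
  by move: mK Km; lia.
by apply/all_iotaP => e /ht; rewrite subnKC // => ->.
Qed.
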